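(* Let $M=\mathbb{C}^2$ with coordinates $(w,z)$, equipped with the generalized complex structure $\mathbb{J}$ defined by the form $\rho=w+dw\wedge dz$, and let $p:\widetilde M\to M$ be the complex blow-up of $M$ at the origin, equipped with the generalized complex structure $\widetilde{\mathbb{J}}$ described in the context. Then any automorphism of $\mathbb{J}$ fixing the origin lifts to $\widetilde M$. That is, if $(\varphi,B)$ is a pair consisting of a diffeomorphism $\varphi$ of $M$ with $\varphi(0)=0$ and a real closed 2-form $B$ on $M$ such that $e^{B}\varphi^*\rho=e^{\lambda}\rho$ for some $\lambda\in C^\infty(M,\mathbb{C})$, then there exists a diffeomorphism $\widetilde\varphi$ of $\widetilde M$ with $p\circ\widetilde\varphi=\varphi\circ p$, and $(\widetilde\varphi,p^*B)$ is an automorphism of $\widetilde{\mathbb{J}}$.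
   Context: A generalized complex structure is determined by its canonical line bundle, a complex line subbundle of $\wedge^\bullet T^*\otimes\mathbb{C}$ generated locally by pure spinors. Here $\mathbb{J}$ is the structure on $\mathbb{C}^2$ whose canonical line is generated by $\rho=w+dw\wedge dz$; equivalently this line is $e^{\sigma}\Omega^{2,0}(M)$ with $\sigma=w\,\partial_w\wedge\partial_z$ (a bivector acts on forms by contraction, normalized so that $e^\sigma(dw\wedge dz)=dw\wedge dz+w$). A 2-form $B$ acts by $e^B\wedge\cdot$. An automorphism of a generalized complex structure with canonical line bundle $K$ is a pair $(\varphi,B)$, with $\varphi$ a diffeomorphism and $B$ a real closed 2-form, such that $e^B\varphi^*K=K$. For $\mathbb{J}$ this says $e^{B}\varphi^*\rho=e^{\lambda}\rho$ for some $\lambda\in C^\infty(M,\mathbb{C})$. The diffeomorphism $\varphi$ is not assumed holomorphic. The blow-up $\widetilde M=[\mathbb{C}^2:0]$ is covered by the charts $(w_0,z_0)=(w/z,z)$ and $(w_1,z_1)=(w,z/w)$. The structure $\widetilde{\mathbb{J}}$ on $\widetilde M$ is the generalized complex structure with canonical line bundle $e^{\widetilde\sigma}\Omega^{2,0}(\widetilde M)$, where $\widetilde\sigma=w_0\partial_{w_0}\wedge\partial_{z_0}=\partial_{w_1}\wedge\partial_{z_1}$ is the lift of $\sigma$; i.e. it is generated by $w_0+dw_0\wedge dz_0$ in the first chart and by $1+dw_1\wedge dz_1$ in the second. *)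

(* Defs.v *)
From HB Require Import structures.
From mathcomp Require Import all_boot all_order all_algebra.
From mathcomp Require Import all_classical all_reals all_analysis.
From mathcomp Require Import complex.

Set Implicit Arguments.
Unset Strict Implicit.
Unset Printing Implicit Defensive.

Import Order.TTheory GRing.Theory Num.Theory.
Import numFieldNormedType.Exports.

Local Open Scope classical_set_scope.
Local Open Scope ring_scope.
Local Open Scope complex_scope.

Section Smooth.
Variables (R : realType) (V W : normedModType R).

(* Only meaningful for open U and finite-dimensional V, where it is the usual
   C^k condition: all iterated directional derivatives of order < k are
   differentiable and those of order k are continuous. *)
Fixpoint Ck (k : nat) (U : set V) (f : V -> W) : Prop :=
  if k is k'.+1 then
    (forall x, U x -> differentiable f x) /\
    (forall v, Ck k' U (fun x => 'D_v f x))
  else forall x, U x -> {for x, continuous f}.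

Definition smooth_on (U : set V) (f : V -> W) : Prop := forall k, Ck k U f.

Definition smooth (f : V -> W) : Prop := smooth_on setT f.

Definition smooth_near (x : V) (f : V -> W) : Prop :=
  exists U : set V, [/\ open U, U x & smooth_on U f].

End Smooth.

Definition diffeomorphism (R : realType) (V : normedModType R) (f : V -> V) :
    Prop :=
  exists g : V -> V, [/\ cancel f g, cancel g f, smooth f & smooth g].

Section ComplexValued.
Variables (R : realType) (V : normedModType R).

Definition csmooth (f : V -> R[i]) : Prop :=
  smooth (fun x => complex.Re (f x) : R) /\
  smooth (fun x => complex.Im (f x) : R).

Definition cderive (f : V -> R[i]) (x v : V) : R[i] :=
  ('D_v (fun y => complex.Re (f y) : R) x) +i*
  ('D_v (fun y => complex.Im (f y) : R) x).

Definition cexp (c : R[i]) : R[i] :=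
  (expR (complex.Re c))%:C * (cos (complex.Im c) +i* sin (complex.Im c)).

End ComplexValued.

(* C^2 as R^4, with real coordinates (Re w, Im w, Re z, Im z). *)
Notation C2 R := 'rV[R]_4.

Section C2.
Variable R : realType.

Definition wc (x : C2 R) : R[i] := x 0 0 +i* x 0 1.
Definition zc (x : C2 R) : R[i] := x 0 2 +i* x 0 3.

Definition mkC2 (w z : R[i]) : C2 R :=
  \row_(j < 4) [:: complex.Re w; complex.Im w; complex.Re z; complex.Im z]`_j.

Definition scaleC2 (c : R[i]) (x : C2 R) : C2 R := mkC2 (c * wc x) (c * zc x).

Lemma wcK w z : wc (mkC2 w z) = w.
Proof. by rewrite /wc !mxE; case: w. Qed.

Lemma zcK w z : zc (mkC2 w z) = z.
Proof. by rewrite /zc !mxE; case: z. Qed.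

Lemma mkC2K x : mkC2 (wc x) (zc x) = x.
Proof.
apply/rowP => j; rewrite mxE /wc /zc /=.
by case: j => [[|[|[|[|//]]]]] ? /=; congr (x 0 _); apply/val_inj.
Qed.

End C2.

Section Exterior.
Variable R : realType.

(* Mixed-degree elements of the exterior algebra of the dual of R^4, with complex
   coefficients: the degree k part is a function of k vectors of R^4, given as
   the rows of a k x 4 matrix.  Alternation is imposed separately, in is_form. *)
Definition ext := forall k : nat, 'M[R]_(k, 4) -> R[i].

Definition is_alternating k (a : 'M[R]_(k, 4) -> R[i]) : Prop :=
  (forall (i : 'I_k) (b c : R) (A A1 A2 : 'M[R]_(k, 4)),
     row i A = b *: row i A1 + c *: row i A2 ->
     row' i A1 = row' i A -> row' i A2 = row' i A ->
     a A = b%:C * a A1 + c%:C * a A2) /\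
  (forall (A : 'M[R]_(k, 4)) (i j : 'I_k),
     i != j -> row i A = row j A -> a A = 0).

Definition ext1 : ext := fun k _ => (k == 0)%:R.

Definition ext_add (a b : ext) : ext := fun k A => a k A + b k A.

Definition ext_scale (c : R[i]) (a : ext) : ext := fun k A => c * a k A.

Definition shuffle_sign m (S : {set 'I_m}) : R[i] :=
  (-1) ^+ #|[pred ij : 'I_m * 'I_m |
              [&& ij.1 \in S, ij.2 \notin S & (ij.2 < ij.1)%N]]|.

(* The sum over shuffles: S is the set of positions of the vectors fed to a, and
   the vectors keep their order.  Thus (a /\ b)(u,v) = a(u) b(v) - a(v) b(u)
   for covectors a, b. *)
Definition wedge (a b : ext) : ext := fun m A =>
  \sum_(S : {set 'I_m})
    shuffle_sign S *
    a #|S| (rowsub (@enum_val _ (mem S)) A) *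
    b #|~: S| (rowsub (@enum_val _ (mem (~: S))) A).

(* The exponential of a 2-covector; the higher powers vanish in dimension 4. *)
Definition ext_exp (b : ext) : ext :=
  ext_add ext1 (ext_add b (ext_scale (2%:R^-1) (wedge b b))).

(* Pullback along the linear map v |-> v *m L. *)
Definition ext_pull (L : 'M[R]_4) (a : ext) : ext := fun k A => a k (A *m L).

Definition ext_line (a : ext) : set ext := range (fun c => ext_scale c a).

End Exterior.

Arguments ext1 {R} k A : rename.
Arguments ext_add {R} a b k A : rename.
Arguments ext_scale {R} c a k A : rename.
Arguments wedge {R} a b k A : rename.
Arguments ext_exp {R} b k A : rename.
Arguments ext_pull {R} L a k A : rename.

Section Forms.
Variable R : realType.

Definition dform := C2 R -> ext R.

Definition is_form (omega : dform) : Prop :=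
  (forall x k, is_alternating (omega x k)) /\
  (forall k A, csmooth (fun x => omega x k A)).

Definition form0 (f : C2 R -> R[i]) : dform :=
  fun x k _ => if k is 0%N then f x else 0.

Definition extd (omega : dform) : dform := fun x k =>
  match k with
  | 0%N => fun _ => 0
  | k'.+1 => fun A =>
      \sum_(i < k'.+1)
        (-1) ^+ i * cderive (fun y => omega y k' (row' i A)) x (row i A)
  end.

Arguments extd omega x k A : clear implicits.

Definition pullback (f : C2 R -> C2 R) (omega : dform) : dform :=
  fun x => ext_pull ('J f x) (omega (f x)).

Definition real_closed_2form (B : dform) : Prop :=
  [/\ is_form B,
      forall x k A, k <> 2%N -> B x k A = 0,
      forall x k A, complex.Im (B x k A) = 0
    & forall x k A, extd B x k A = 0].

Definition dw_dz : dform :=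
  fun x => wedge (extd (form0 (@wc R)) x) (extd (form0 (@zc R)) x).

Definition rho : dform := fun x => ext_add (form0 (@wc R) x) (dw_dz x).

End Forms.

Arguments form0 {R} f x k A : rename.
Arguments extd {R} omega x k A : rename.
Arguments pullback {R} f omega x k A : rename.
Arguments dw_dz {R} x k A : rename.
Arguments rho {R} x k A : rename.

Section Blowup.
Variable R : realType.

Definition cline (u : C2 R) : set (C2 R) := range (fun c => scaleC2 c u).

(* Pairs of a point of C^2 and a complex line through 0 and that point. *)
Record blowup := Blowup {
  blowdown : C2 R;
  bl_line : set (C2 R);
  bl_lineP : exists2 u, u != 0 & bl_line = cline u;
  bl_mem : bl_line blowdown }.

Lemma chart0_lineP (x : C2 R) :
  exists2 u, u != 0 & cline (mkC2 (wc x) 1) = cline u.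
Proof.
exists (mkC2 (wc x) 1) => //; apply/eqP => /(congr1 (@zc R)).
by rewrite zcK /zc !mxE => /eqP; rewrite eq_complex /= oner_eq0.
Qed.

Lemma chart0_mem (x : C2 R) :
  cline (mkC2 (wc x) 1) (mkC2 (wc x * zc x) (zc x)).
Proof. by exists (zc x) => //; rewrite /scaleC2 wcK zcK mulr1 mulrC. Qed.

Lemma chart1_lineP (x : C2 R) :
  exists2 u, u != 0 & cline (mkC2 1 (zc x)) = cline u.
Proof.
exists (mkC2 1 (zc x)) => //; apply/eqP => /(congr1 (@wc R)).
by rewrite wcK /wc !mxE => /eqP; rewrite eq_complex /= oner_eq0.
Qed.

Lemma chart1_mem (x : C2 R) :
  cline (mkC2 1 (zc x)) (mkC2 (wc x) (wc x * zc x)).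
Proof. by exists (wc x) => //; rewrite /scaleC2 wcK zcK mulr1. Qed.

(* The inverses of the two charts, both defined on all of C^2:
   false is (w0,z0) = (w/z,z) and true is (w1,z1) = (w,z/w). *)
Definition chart (i : bool) (x : C2 R) : blowup :=
  if i then Blowup (chart1_lineP x) (chart1_mem x)
  else Blowup (chart0_lineP x) (chart0_mem x).

Lemma blowup_eq (p q : blowup) :
  blowdown p = blowdown q -> bl_line p = bl_line q -> p = q.
Proof.
case: p q => [x L HL Hx] [y M HM Hy] /= exy eLM.
by subst y M; congr Blowup; apply: Prop_irrelevance.
Qed.

Lemma chart_inj i : injective (chart i).
Proof.
case: i => x y exy; have /= eL := congr1 bl_line exy.
  have /= /(congr1 (@wc R)) := congr1 blowdown exy; rewrite !wcK => ew.
  have: cline (mkC2 1 (zc y)) (mkC2 1 (zc x)).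
    by rewrite -eL; exists 1 => //; rewrite /scaleC2 !mul1r mkC2K.
  move=> [c _ e]; have := congr1 (@wc R) e; have := congr1 (@zc R) e.
  rewrite /scaleC2 !wcK !zcK mulr1 => ez ec.
  by rewrite -[x]mkC2K -[y]mkC2K ew -ez ec mul1r.
have /= /(congr1 (@zc R)) := congr1 blowdown exy; rewrite !zcK => ez.
have: cline (mkC2 (wc y) 1) (mkC2 (wc x) 1).
  by rewrite -eL; exists 1 => //; rewrite /scaleC2 !mul1r mkC2K.
move=> [c _ e]; have := congr1 (@wc R) e; have := congr1 (@zc R) e.
rewrite /scaleC2 !wcK !zcK mulr1 => ec ew.
by rewrite -[x]mkC2K -[y]mkC2K ez -ew ec mul1r.
Qed.

Lemma chart_cover (p : blowup) : exists i x, chart i x = p.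
Proof.
have ccline (c : R[i]) u : c != 0 -> cline (scaleC2 c u) = cline u.
  move=> c0; apply/seteqP; split => v [d _ <-].
    by exists (d * c) => //; rewrite /scaleC2 !wcK !zcK !mulrA.
  exists (d / c) => //.
  by rewrite /scaleC2 !wcK !zcK !mulrA divfK.
have [u u0 eL] := bl_lineP p.
have := bl_mem p; rewrite eL => -[c _ ec].
have [w0|w0] := eqVneq (wc u) 0; last first.
  exists true, (mkC2 (c * wc u) (zc u / wc u)); apply: blowup_eq => /=.
    by rewrite -ec wcK zcK /scaleC2 -mulrA [wc u * _]mulrC divfK.
  rewrite eL zcK -(ccline (wc u)^-1 u) ?invr_eq0 //.
  by rewrite /scaleC2 mulVf // [_^-1 * _]mulrC.
have z0 : zc u != 0.
  apply: contra_neq u0 => z0; rewrite -[u]mkC2K w0 z0.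
  by apply/rowP => j; rewrite !mxE; case: j => [[|[|[|[|//]]]]].
exists false, (mkC2 0 (c * zc u)); apply: blowup_eq => /=.
  by rewrite -ec wcK zcK /scaleC2 w0 mulr0 mul0r.
rewrite eL wcK -(ccline (zc u)^-1 u) ?invr_eq0 //.
by rewrite /scaleC2 mulVf // w0 mulr0.
Qed.

(* g is the expression of f near the point of coordinates x in chart i, read
   in chart j. *)
Definition local_expr (f : blowup -> blowup) (i j : bool) (x : C2 R)
    (g : C2 R -> C2 R) : Prop :=
  smooth_near x g /\ (\forall y \near x, chart j (g y) = f (chart i y)).

Definition bl_smooth (f : blowup -> blowup) : Prop :=
  forall i x, exists j g, local_expr f i j x g.

Definition bl_diffeomorphism (f : blowup -> blowup) : Prop :=
  exists g, [/\ cancel f g, cancel g f, bl_smooth f & bl_smooth g].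

(* A form on the blow-up is given by its expressions in the two charts. *)
Definition bl_form := bool -> dform R.

Definition bl_compatible (omega : bl_form) : Prop :=
  forall i j x g, local_expr id i j x g -> omega i x = pullback g (omega j) x.

Definition bl_real_closed_2form (omega : bl_form) : Prop :=
  bl_compatible omega /\ forall i, real_closed_2form (omega i).

Definition blowdown_pullback (omega : dform R) : bl_form :=
  fun i => pullback (fun x => blowdown (chart i x)) omega.

Definition bl_rho (i : bool) : dform R :=
  if i then fun x => ext_add ext1 (dw_dz x) else rho.

Definition bl_canonical (i : bool) (x : C2 R) : set (ext R) :=
  ext_line (bl_rho i x).

(* The last clause is e^B f^*K = K at the point chart i x; it does not depend on
   the local expression g of f. *)
Definition bl_automorphism (f : blowup -> blowup) (B : bl_form) : Prop :=
  [/\ bl_diffeomorphism f, bl_real_closed_2form B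
    & forall i j x g, local_expr f i j x g ->
        (fun a => wedge (ext_exp (B i x)) (ext_pull ('J g x) a))
          @` bl_canonical j (g x)
        = bl_canonical i x].

End Blowup.

(* Main.v *)
Require Import Defs.
From HB Require Import structures.
From mathcomp Require Import all_boot all_order all_algebra.
From mathcomp Require Import all_classical all_reals all_analysis.
From mathcomp Require Import complex ring lra.

(** Write phi = (a, b) in the coordinates (w, z), and let u be the nowhere
    vanishing function e^lambda. The degree 0 part of the equation
    e^B phi^*rho = u rho says that a = u w, and its degree 2 part that
    da /\ db + a B = u dw /\ dz. Modulo w the latter becomes
    dw /\ d(b - z) = 0: the differential of b - z is the sum of a multiple of dw
    and of w times a smooth 1-form ([cderive_auto]). In particular the derivative
    of b - z along the radial direction at y is w(y) K(y) with K smooth. As phi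
    fixes the origin, b - z vanishes there, and integrating along rays gives
    b = z + h w with h(x) the average of K on the segment from 0 to x
    ([cray_FTC], [automorphism_normal_form]). This h is smooth because averages
    can be differentiated under the integral sign ([ray_mean_diff]).

    Consequently phi x = M(x) x for a smooth family of invertible complex
    matrices M(x) with rows (u, 0) and (h, 1). The family acts on complex lines,
    and (x, L) |-> (phi x, M(x) L) is a lift of phi to the blow-up. It is smooth
    in the charts ([lift_local_expr]), and so is its inverse, since the inverse
    of phi admits a factorisation of the same kind ([twisted_inverse]).

    In each chart the blow-down map pulls rho back to the generator of the lifted
    structure times the local equation of the exceptional divisor
    ([pullback_monoidal_rho]). The lift multiplies these equations by nonzero
    functions ([lift_local_coeff]), because M(x) is invertible. Pulling back the
    equation satisfied by phi therefore yields the required equation up to a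
    factor that vanishes exactly on the exceptional divisor; off the divisor it
    can be cancelled, and the result holds everywhere by continuity
    ([lift_equation]). Finally the pullback of B is closed because exterior
    differentiation commutes with pullback ([pullback_real_closed]). *)

Set Implicit Arguments.
Unset Strict Implicit.
Unset Printing Implicit Defensive.

Import Order.TTheory GRing.Theory Num.Theory.
Import numFieldNormedType.Exports.

Local Open Scope classical_set_scope.
Local Open Scope ring_scope.
Local Open Scope complex_scope.

(** * Calculus of maps of class C^k *)

Section CkCalculus.
Variables (R : realType) (V : normedModType R).
Implicit Types (U : set V) (k : nat) (v : V).

Lemma differentiable_approx (W : normedModType R) (f : V -> W) x :
  differentiable f x -> forall e, 0 < e ->
  \forall h \near 0, `|f (h + x) - f x - 'd f x h| <= e * `|h|.
Proof.
move=> /diff_locallyP[_ /eqaddoP H] e e0.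
have := H e e0; apply: filterS => h /=.
by rewrite -[X in `|X| <= _ -> _]/(f (h + x) - (f x + 'd f x h)) opprD addrA.
Qed.

(** The differential is selected by a choice operator; the little-o estimate
    identifies it, and with it all directional derivatives. *)
Lemma approx_differentiable (W : normedModType R) (f L : V -> W) x :
  linear L -> continuous L ->
  (forall e, 0 < e ->
    \forall h \near 0, `|f (h + x) - f x - L h| <= e * `|h|) ->
  differentiable f x /\ forall v, 'D_v f x = L v.
Proof.
move=> lL cL H.
pose Lm := GRing.isLinear.Build _ _ _ _ _ lL.
pose LL : {linear V -> W} := HB.pack L Lm.
have dxf : f \o shift x = cst (f x) + LL +o_ (0:V) id.
  apply: eqaddoE; apply/eqaddoP => e e0; have := H e e0; apply: filterS => h.
  by rewrite -[X in _ -> `|X| <= _]/(f (h + x) - (f x + L h)) opprD addrA.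
have dE := @diff_unique _ _ _ f LL x cL dxf.
have df : differentiable f x by apply/diff_locallyP; rewrite dE; split.
by split => // v; rewrite deriveE // dE.
Qed.

Lemma linear_post_differentiable (W W' : normedModType R) (L : W -> W')
    (f : V -> W) x : linear L -> continuous L -> differentiable f x ->
  differentiable (L \o f) x /\ forall v, 'D_v (L \o f) x = L ('D_v f x).
Proof.
move=> lL cL df.
pose Lm := GRing.isLinear.Build _ _ _ _ _ lL.
pose LL : {linear W -> W'} := HB.pack L Lm.
have dL : differentiable LL (f x) by exact: linear_differentiable.
split; first exact: (differentiable_comp df dL).
move=> v; rewrite deriveE; last exact: (differentiable_comp df dL).
rewrite (diff_comp df dL) /= -(deriveE v df).
exact: (congr1 (fun g : W -> W' => g ('D_v f x)) (@diff_lin _ _ _ LL _ cL)).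
Qed.

Lemma near_eq_differentiable (W : normedModType R) (f g : V -> W) x :
  (\forall y \near x, f y = g y) -> differentiable f x -> differentiable g x.
Proof.
move=> fg df.
apply: (proj1 (@approx_differentiable W g ('d f x) x _ _ _)).
- exact: linearP.
- exact: diff_continuous.
move=> e e0; have gx := nbhs_singleton fg.
have fg0 : \forall h \near 0, f (h + x) = g (h + x).
  have := fg; rewrite (near_shift 0) /=; apply: filterS => h /=.
  by rewrite subr0.
by apply: filterS2 fg0 (differentiable_approx df e0) => h <-; rewrite -gx.
Qed.

(** Derivatives at a point of an open set depend only on the values nearby. *)
Lemma Ck_eq k (W : normedModType R) U (f g : V -> W) :
  open U -> (forall x, U x -> f x = g x) -> Ck k U f -> Ck k U g.
Proof.
move=> oU; elim: k f g => [|k IH] f g fg /=.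
  move=> cf x Ux.
  have nfg : \forall y \near x, f y = g y.
    by apply: filterS (open_nbhs_nbhs (conj oU Ux)).
  change (g y @[y --> x] --> g x); rewrite -(fg x Ux).
  apply: cvg_trans (cf x Ux).
  exact: near_eq_cvg.
have nfg x : U x -> \forall y \near x, f y = g y.
  by move=> Ux; apply: filterS (open_nbhs_nbhs (conj oU Ux)).
move=> [df cf]; split => [x Ux|v].
  by apply: near_eq_differentiable (nfg x Ux) (df x Ux).
by apply: IH (cf v) => x /nfg; exact: near_eq_derive.
Qed.

Lemma Ck_continuous k (W : normedModType R) U (f : V -> W) :
  Ck k U f -> forall x, U x -> {for x, continuous f}.
Proof.
by case: k => [//|k] [df _] x Ux; exact/differentiable_continuous/df.
Qed.

Lemma Ck_pred k (W : normedModType R) U (f : V -> W) : Ck k.+1 U f -> Ck k U f.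
Proof.
elim: k f => [|k IH] f; first by move=> [df _] x /df/differentiable_continuous.
by move=> [df cf]; split => // v; exact/IH/cf.
Qed.

Lemma Ck_sub k (W : normedModType R) U U' (f : V -> W) :
  U' `<=` U -> Ck k U f -> Ck k U' f.
Proof.
move=> sU; elim: k f => [|k IH] f /=; first by move=> cf x /sU; exact: cf.
by move=> [df cf]; split => [x /sU|v]; [exact: df|exact/IH/cf].
Qed.

Lemma Ck_cst k (W : normedModType R) U (a : W) : Ck k U (cst a).
Proof.
elim: k a => [|k IH] a /=; first by move=> x _; exact: cst_continuous.
split=> [x _|v]; first exact: differentiable_cst.
rewrite (_ : (fun x => _) = cst 0); first exact: IH.
by apply/funext => x; rewrite derive_cst.
Qed.

Lemma Ck_add k (W : normedModType R) U (f g : V -> W) : open U ->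
  Ck k U f -> Ck k U g -> Ck k U (f \+ g).
Proof.
move=> oU; elim: k f g => [|k IH] f g /=.
  by move=> cf cg x Ux; apply: continuousD; [exact: cf|exact: cg].
move=> [df cf] [dg cg]; split => [x Ux|v].
  by apply: differentiableD; [exact: df|exact: dg].
apply: Ck_eq (IH _ _ (cf v) (cg v)) => // x Ux.
by rewrite deriveD; [|exact/diff_derivable/df|exact/diff_derivable/dg].
Qed.

(** Differentiation commutes with a continuous linear map. Taking a
    coordinate and multiplying a fixed vector are the instances that reduce
    vector-valued maps to scalar ones. *)
Lemma Ck_linear_post k (W W' : normedModType R) (L : W -> W') U (f : V -> W) :
  open U -> linear L -> continuous L -> Ck k U f -> Ck k U (L \o f).
Proof.
move=> oU lL cL; elim: k f => [|k IH] f /=.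
  by move=> cf x Ux; apply: continuous_comp; [exact: cf|exact: cL].
move=> [df cf]; split => [x /df /(linear_post_differentiable lL cL)[]//|v].
apply: Ck_eq (IH _ (cf v)) => // x Ux /=.
by have [_ ->] := linear_post_differentiable lL cL (df x Ux).
Qed.

Lemma Ck_id k U : Ck k U (@id V).
Proof.
case: k => [|k]; first by move=> x _; exact: cvg_id.
split=> [x _|v]; first by exact: ex_diff.
rewrite (_ : (fun x => _) = cst v); first exact: Ck_cst.
by apply/funext => x; rewrite derive_id.
Qed.

(** The Leibniz rule expresses the derivatives by products involving f and g
    themselves at the lower order, hence the appeal to [Ck_pred]. *)
Lemma Ck_mul k U (f g : V -> R) : open U ->
  Ck k U f -> Ck k U g -> Ck k U (fun x => f x * g x).
Proof.
move=> oU; elim: k f g => [|k IH] f g.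
  by move=> cf cg x Ux; apply: continuousM; [exact: cf|exact: cg].
move=> Cf Cg; have [df cf] := Cf; have [dg cg] := Cg.
split => [x Ux|v]; first by apply: differentiableM; [exact: df|exact: dg].
have H1 := IH _ _ (Ck_pred Cf) (cg v); have H2 := IH _ _ (Ck_pred Cg) (cf v).
apply: Ck_eq (Ck_add oU H1 H2) => // x Ux /=.
by rewrite deriveM; [|exact/diff_derivable/df|exact/diff_derivable/dg].
Qed.

Lemma Ck_opp k U (f : V -> R) : open U -> Ck k U f -> Ck k U (fun x => - f x).
Proof.
move=> oU cf; have C1 : Ck k U (cst (-1) : V -> R) by exact: Ck_cst.
by apply: Ck_eq (Ck_mul oU C1 cf) => // x _ /=; rewrite mulN1r.
Qed.

Lemma Ck_inv k U (f : V -> R) : open U -> (forall x, U x -> f x != 0) ->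
  Ck k U f -> Ck k U (fun x => (f x)^-1).
Proof.
move=> oU f0; elim: k => [|k IH].
  by move=> cf x Ux; apply: cvgV; [exact: f0|exact: cf].
move=> Cf; have [df cf] := Cf; have Ci := IH (Ck_pred Cf).
split => [x Ux|v]; first by apply: differentiableV; [exact: df|exact: f0].
have H := Ck_opp oU (Ck_mul oU (Ck_mul oU Ci Ci) (cf v)).
apply: Ck_eq H => // x Ux /=.
rewrite deriveV; [|exact: f0|exact/diff_derivable/df].
by rewrite expr2 invfM scaleNr.
Qed.

End CkCalculus.

Section CkVector.
Variables (R : realType) (V : normedModType R).
Implicit Types (U : set V) (k : nat) (v : V).

Lemma Ck_sum k (W : normedModType R) U (I : Type) (r : seq I)
    (f : I -> V -> W) : open U -> (forall i, Ck k U (f i)) ->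
  Ck k U (fun x => \sum_(i <- r) f i x).
Proof.
move=> oU Cf; elim: r => [|i r IH].
  apply: Ck_eq (@Ck_cst _ _ k _ U (0 : W)) => // x _ /=.
  by rewrite big_nil.
by apply: Ck_eq (Ck_add oU (Cf i) IH) => // x _ /=; rewrite big_cons.
Qed.

Lemma Ck_coord k n U (g : V -> 'rV[R]_n) j : open U ->
  Ck k U g -> Ck k U (fun x => g x 0 j : R).
Proof.
move=> oU; apply: (@Ck_linear_post _ _ k _ _ (fun M : 'rV[R]_n => M 0 j : R)).
- exact: oU.
- by move=> a M N; rewrite !mxE.
- exact: coord_continuous.
Qed.

Lemma Ck_rV k n U (g : V -> 'rV[R]_n) : open U ->
  (forall j, Ck k U (fun x => g x 0 j : R)) -> Ck k U g.
Proof.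
move=> oU Cg.
have Cj j : Ck k U (fun x => g x 0 j *: delta_mx 0 j : 'rV[R]_n).
  apply: (@Ck_linear_post _ _ k _ _
    (fun a : R => a *: delta_mx 0 j : 'rV[R]_n)); first exact: oU.
  - by move=> a b c; rewrite scalerDl scalerA.
  - by move=> a; exact: scalel_continuous.
  - exact: Cg.
apply: Ck_eq (Ck_sum (index_enum 'I_n) oU Cj) => // x _ /=.
by rewrite [RHS]row_sum_delta.
Qed.

Lemma derive_rV_sum n (F : 'rV[R]_n -> R) y (h : 'rV[R]_n) :
  differentiable F y -> 'D_h F y = \sum_j h 0 j * 'D_('e_j) F y.
Proof.
move=> dF; rewrite deriveE // {1}[h]row_sum_delta linear_sum /=.
by apply: eq_bigr => j _; rewrite linearZ deriveE.
Qed.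

Lemma differentiable_post (W W' : normedModType R) (F : W -> W') (g : V -> W) x :
  differentiable g x -> differentiable F (g x) ->
  differentiable (F \o g) x /\
  forall v, 'D_v (F \o g) x = 'D_('D_v g x) F (g x).
Proof.
move=> dg dF; have dc := differentiable_comp dg dF; split => // v.
by rewrite !deriveE // diff_comp.
Qed.

(** By the chain rule D_v (F o g) is the sum of the D_v g_j times
    (D_j F) o g, so the induction on k has to be uniform in F. *)
Lemma Ck_comp k n U (U' : set 'rV[R]_n) (F : 'rV[R]_n -> R)
    (g : V -> 'rV[R]_n) : open U -> (forall x, U x -> U' (g x)) ->
  Ck k U' F -> Ck k U g -> Ck k U (F \o g).
Proof.
move=> oU gU; elim: k F => [|k IH] F.
  by move=> cF cg x Ux; apply: continuous_comp; [exact: cg|exact/cF/gU].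
move=> [dF cF] Cg; have [dg cg] := Cg.
split=> [x Ux|v].
  by have [] := differentiable_post (dg x Ux) (dF _ (gU x Ux)).
have Cj j : Ck k U (fun x => 'D_v g x 0 j * ('D_('e_j) F \o g) x).
  apply: Ck_mul => //; first exact: Ck_coord (cg v).
  exact: IH (cF _) (Ck_pred Cg).
apply: Ck_eq (Ck_sum (index_enum 'I_n) oU Cj) => // x Ux /=.
have [_ ->] := differentiable_post (dg x Ux) (dF _ (gU x Ux)).
by rewrite derive_rV_sum //; exact/dF/gU.
Qed.

End CkVector.

(** * Averages over the unit interval *)

Section Mean.
Variable R : realType.
Implicit Types (g A : R -> R).

Definition mean g : R := (\int[lebesgue_measure]_(t in `[0, 1]) g t)%R.

(** The integral starts at -1, so that all of [0, 1] lies in the interior of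
    the domain and the primitive has two-sided derivatives at 0 and 1. *)
Lemma ex_primitive g : continuous g ->
  exists A, forall t : R, t \in `[0, 1] -> is_derive t 1 A (g t).
Proof.
move=> cg.
have ig : lebesgue_measure.-integrable `[-1, 3] (EFin \o g).
  apply: continuous_compact_integrable; first exact: segment_compact.
  exact: continuous_subspaceT.
exists (fun x => \int[lebesgue_measure]_(t in `[-1, x]) g t)%R => t.
rewrite in_itv /= => /andP[t0 t1].
have [||d e] := @continuous_FTC1_closed R g (-1) t 3 _ ig _ (cg t).
- lra.
- lra.
by rewrite derive1E in e; apply: DeriveDef.
Qed.

(** Averages are computed through primitives: linearity and bounds are then
    inherited from derivatives and from the mean value theorem. *)
Lemma mean_primitive g A : continuous g ->
  (forall t : R, t \in `[0, 1] -> is_derive t 1 A (g t)) -> mean g = A 1 - A 0.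
Proof.
move=> cg dA; rewrite /mean /Rintegral.
have cA (t : R) : t \in `[0, 1] -> {for t, continuous A}.
  by move=> /dA [d _]; apply/differentiable_continuous/derivable1_diffP.
rewrite (@continuous_FTC2 R g A 0 1) //.
- exact: continuous_subspaceT.
- split => /=.
  + by move=> t /subset_itv_oo_cc /dA [].
  + by apply: cvg_at_right_filter; apply: cA; rewrite in_itv /= lexx ler01.
  + by apply: cvg_at_left_filter; apply: cA; rewrite in_itv /= lexx ler01.
- by move=> t /subset_itv_oo_cc /dA [_ <-]; rewrite derive1E.
Qed.

Lemma primitive_bound g A (e : R) :
  (forall t : R, t \in `[0, 1] -> is_derive t 1 A (g t)) ->
  (forall t : R, t \in `[0, 1] -> `|g t| <= e) -> `|A 1 - A 0| <= e.
Proof.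
move=> dA ge.
have cA : {within `[0, 1], continuous A}.
  apply: derivable_within_continuous => t /dA [d _] //.
have dA' (t : R) : t \in `]0, 1[ -> is_derive t 1 A (g t).
  by move=> t01; apply: dA; exact: subset_itv_oo_cc.
have [c c01 E] := MVT_segment ler01 dA' cA.
by rewrite E subr0 mulr1; exact: ge.
Qed.

Lemma mean_le g (e : R) : continuous g ->
  (forall t : R, t \in `[0, 1] -> `|g t| <= e) -> `|mean g| <= e.
Proof.
move=> cg ge; have [A dA] := ex_primitive cg.
by rewrite (mean_primitive cg dA); exact: primitive_bound dA ge.
Qed.

Lemma mean_lin (a : R) f g : continuous f -> continuous g ->
  mean (fun t => a * f t + g t) = a * mean f + mean g.
Proof.
move=> cf cg; have [A dA] := ex_primitive cf; have [B dB] := ex_primitive cg.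
rewrite (mean_primitive cf dA) (mean_primitive cg dB).
have cfg : continuous (fun t => a * f t + g t).
  move=> t; apply: cvgD; last exact: cg.
  by apply: cvgM; [exact: cvg_cst|exact: cf].
have dAB (t : R) : t \in `[0, 1] ->
    is_derive t 1 (a *: A + B) (a * f t + g t).
  by move=> t01; have ? := dA t t01; have ? := dB t t01; exact: is_deriveD.
rewrite (mean_primitive cfg dAB) !fctE /= /GRing.scale /=.
ring.
Qed.

Lemma mean_dist (e : R) f g : continuous f -> continuous g ->
  (forall t : R, t \in `[0, 1] -> `|f t - g t| <= e) ->
  `|mean f - mean g| <= e.
Proof.
move=> cf cg H.
have -> : mean f - mean g = mean (fun t => -1 * g t + f t).
  by rewrite mean_lin // mulN1r addrC.
apply: mean_le => [t|t /H]; last by rewrite mulN1r addrC.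
by apply: cvgD (cf t); apply: cvgM (cg t); exact: cvg_cst.
Qed.

End Mean.

(** * Averages along rays from the origin *)

Section RayMean.
Variables (R : realType) (n : nat).
Local Notation E := 'rV[R]_n.
Implicit Types (F G : E -> R) (x h v : E).

(** The weights make the family stable under differentiation: D_v turns the
    average of F of weight p into the average of D_v F of weight p + 1. *)
Definition ray_mean p F x : R := mean (fun t => t ^+ p * F (t *: x)).

Lemma ray_weight_continuous p F x :
  continuous F -> continuous (fun t : R => t ^+ p * F (t *: x)).
Proof.
move=> cF t; apply: cvgM; first exact: exprn_continuous.
apply: (@continuous_comp _ _ _ (fun t : R => t *: x) F t); last exact: cF.
exact: scalel_continuous.
Qed.

(** Continuity of G is uniform along the compact segment from 0 to x. *)
Lemma tube G x (e : R) : continuous G -> 0 < e ->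
  exists2 r : R, 0 < r & forall h (t : R), `|h| < r -> t \in `[0, 1] ->
    `|G (t *: x + h) - G (t *: x)| <= e.
Proof.
move=> cG e0.
have /compact_near_coveringP cov := @segment_compact R 0 1.
pose P h (t : R) := `|G (t *: x + h) - G (t *: x)| <= e.
have : \forall h \near (0 : E), `[0, 1] `<=` P h.
  apply: (cov E (nbhs (0 : E)) P) => t _.
  have c1 : (G (z.1 *: x + z.2) - G (z.1 *: x)) @[z --> (t, 0 : E)] --> (0 : R).
    rewrite -[X in _ --> X](subrr (G (t *: x))); apply: cvgB.
      rewrite -[in X in _ --> X](addr0 (t *: x)).
      apply: (@continuous_comp _ _ _ (fun z : R * E => z.1 *: x + z.2) G (t, 0));
        last exact: cG.
      apply: cvgD; last exact: cvg_snd.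
      by apply: cvgZr_tmp; exact: cvg_fst.
    apply: (@continuous_comp _ _ _ (fun z : R * E => z.1 *: x) G (t, 0));
      last exact: cG.
    by apply: cvgZr_tmp; exact: cvg_fst.
  have /cvgr0Pnorm_le /(_ e e0) := c1.
  by [].
move=> /nbhs_ballP[r /= r0 Hr]; exists r => // h t hr t01; apply: Hr => //.
by rewrite -ball_normE /= sub0r normrN.
Qed.

Lemma norm_segment (t : R) h : t \in `[0, 1] -> `|t *: h| <= `|h|.
Proof.
by rewrite in_itv /= => /andP[t0 t1]; rewrite normrZ ger0_norm // ler_piMl.
Qed.

Lemma weight_le p (t a e : R) : t \in `[0, 1] -> `|a| <= e ->
  `|t ^+ p * a| <= e.
Proof.
rewrite in_itv /= => /andP[t0 t1] ae.
rewrite normrM ger0_norm ?exprn_ge0 // (le_trans _ ae) //.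
by rewrite ler_piMl // exprn_ile1.
Qed.

Lemma ray_mean_continuous p F : continuous F -> continuous (ray_mean p F).
Proof.
move=> cF x; have fx : Filter (nbhs x) by exact: nbhs_filter.
apply/(@cvgrPdist_le _ _ _ _ fx) => e e0.
have [r r0 Hr] := tube x cF e0.
apply: (@filterS _ (nbhs x) fx _ _ _ (nbhsx_ballx x r r0)) => y.
rewrite -ball_normE /= distrC => yr.
rewrite distrC; apply: mean_dist => [||t t01]; try exact: ray_weight_continuous.
rewrite -mulrBr; apply: weight_le => //.
have -> : t *: y = t *: x + t *: (y - x) by rewrite scalerBr addrC subrK.
by apply: Hr => //; exact: le_lt_trans (norm_segment _ t01) yr.
Qed.

Lemma affine_path (a w : E) (s : R) :
  differentiable (fun s : R => a + s *: w) s /\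
  'D_1 (fun s : R => a + s *: w) s = w.
Proof.
have [||e e0|d D] := @approx_differentiable _ R E (fun s : R => a + s *: w)
  (fun s : R => s *: w) s.
- by move=> b t u; rewrite scalerDl scalerA.
- by move=> t; exact: scalel_continuous.
- near=> h.
  have -> : a + (h + s) *: w - (a + s *: w) - h *: w = 0.
    by rewrite scalerDl opprD addrACA subrr add0r addrK subrr.
  by rewrite normr0 mulr_ge0 // ltW.
by split => //; rewrite D scale1r.
Unshelve. all: by end_near. Qed.

(** A first-order Taylor estimate that is uniform on the segment: by the mean
    value theorem in the direction t h, the error is t times the difference of
    the values of D_h F at two points less than r apart. *)
Lemma ray_mvt F x h (e r : R) : (forall y, differentiable F y) ->
  (forall j k (t : R), `|k| < r -> t \in `[0, 1] ->
    `|'D_('e_j) F (t *: x + k) - 'D_('e_j) F (t *: x)| <= e) ->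
  `|h| < r -> forall t : R, t \in `[0, 1] ->
  `|F (t *: x + t *: h) - F (t *: x) - t * 'D_h F (t *: x)| <= e *+ n * `|h|.
Proof.
move=> dF He hr t t01.
pose f (s : R) := F (t *: x + s *: (t *: h)).
have df (s : R) : is_derive s 1 f (t * 'D_h F (t *: x + s *: (t *: h))).
  have [dl Dl] := affine_path (t *: x) (t *: h) s.
  have [dc Dc] := differentiable_post dl (dF _).
  apply: DeriveDef; first exact: diff_derivable.
  rewrite Dc Dl !deriveE; [|exact: dF|exact: dF].
  by rewrite linearZ.
have df' (s : R) : s \in `]0, 1[ ->
  is_derive s 1 f (t * 'D_h F (t *: x + s *: (t *: h))) by [].
have cf : {within `[0, 1], continuous f}.
  by apply: derivable_within_continuous => s _; have [] := df s.
have [c c01 Ec] := MVT_segment ler01 df' cf.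
move: Ec; rewrite /f scale1r scale0r addr0 subr0 mulr1 => ->.
rewrite -mulrBr -[t]expr1; apply: weight_le => //.
rewrite (derive_rV_sum _ (dF _)) (derive_rV_sum _ (dF (t *: x))) -sumrB.
rewrite (le_trans (ler_norm_sum _ _ _)) //.
have -> : e *+ n * `|h| = \sum_(j < n) (`|h| * e).
  by rewrite sumr_const card_ord mulrnAl mulrC.
apply: ler_sum => j _; rewrite -mulrBr normrM ler_pM //.
  rewrite [leRHS]/Num.Def.normr/= mx_normrE.
  exact: (le_bigmax _ (fun ij : 'I_1 * 'I_n => `|h ij.1 ij.2|) (0, j)).
rewrite expr1; apply: He => //; apply: le_lt_trans hr.
exact: le_trans (norm_segment _ c01) (norm_segment _ t01).
Qed.

(** Differentiation under the integral sign: the estimate of [ray_mvt] does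
    not depend on t and therefore survives averaging. *)
Lemma ray_mean_diff p F x : Ck 1 setT F ->
  differentiable (ray_mean p F) x /\
  forall v, 'D_v (ray_mean p F) x = ray_mean p.+1 (fun y => 'D_v F y) x.
Proof.
move=> CF; have [dF' cD'] := CF.
have dF y : differentiable F y by exact: dF'.
have cD v : continuous (fun y => 'D_v F y) by move=> y; exact: cD'.
have cF : continuous F by move=> y; exact: differentiable_continuous.
have cW q y : continuous (fun t : R => t ^+ q * F (t *: y)).
  exact: ray_weight_continuous.
have cWD q v y : continuous (fun t : R => t ^+ q * 'D_v F (t *: y)).
  exact: (@ray_weight_continuous q (fun y => 'D_v F y) y (cD v)).
have lD (a : R) u v y : 'D_(a *: u + v) F y = a * 'D_u F y + 'D_v F y.
  by rewrite !deriveE // linearP.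
pose L v := ray_mean p.+1 (fun y => 'D_v F y) x.
have lL : linear L.
  move=> a u v; rewrite /L /ray_mean -mean_lin; try by [exact: cW|exact: cWD].
  by congr mean; apply/funext => t; rewrite lD; ring.
pose Lm := GRing.isLinear.Build _ _ _ _ _ lL.
pose LL : {linear E -> R} := HB.pack L Lm.
have cL : continuous L.
  have -> : L = fun v => \sum_j v 0 j * L 'e_j.
    apply/funext => v; rewrite -[L]/(LL : E -> R) {1}[v]row_sum_delta linear_sum.
    by apply: eq_bigr => j _; rewrite linearZ.
  have C0 j : Ck 0 setT (fun v : E => v 0 j * L 'e_j).
    apply: (@Ck_mul _ _ 0 _ (fun v : E => v 0 j) (fun=> L 'e_j)).
    - exact: openT.
    - by move=> v _; exact: coord_continuous.
    - exact: (@Ck_cst _ _ 0).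
  by move=> v; exact: (Ck_sum (index_enum 'I_n) openT C0 v I).
apply: approx_differentiable => // e e0.
(* the n coordinates of a direction each contribute one error term *)
have e1 : 0 < e / n.+1%:R by rewrite divr_gt0.
have /choice [r Hr] : forall j : 'I_n, exists r : R, 0 < r /\
   forall h (t : R), `|h| < r -> t \in `[0, 1] ->
    `|'D_('e_j) F (t *: x + h) - 'D_('e_j) F (t *: x)| <= e / n.+1%:R.
  by move=> j; have [r r0 Hr] := tube x (cD 'e_j) e1; exists r.
pose r0 := \big[Num.min/1]_j r j.
have r00 : 0 < r0.
  apply: (big_ind (fun y : R => 0 < y)) => [|a b a0 b0|j _].
  - exact: ltr01.
  - by rewrite lt_min a0 b0.
  - by have [] := Hr j.
have f0 : Filter (nbhs (0 : E)) by exact: nbhs_filter.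
apply: (@filterS _ _ f0 _ _ _ (nbhsx_ballx (0 : E) r0 r00)) => h.
rewrite -ball_normE /= sub0r normrN => hr.
rewrite [h + x]addrC /L -[_ - _ - _]addrA -opprD.
rewrite /ray_mean.
rewrite -[X in X + mean _]mul1r -mean_lin; try by [exact: cW|exact: cWD].
apply: mean_dist => [||t t01]; try by [exact: cW|exact: cWD].
  move=> t; apply: cvgD; last exact: cWD.
  by apply: cvgM; [exact: cvg_cst|exact: cW].
have -> : t ^+ p * F (t *: (x + h)) -
    (1 * (t ^+ p * F (t *: x)) + t ^+ p.+1 * 'D_h F (t *: x)) =
   t ^+ p * (F (t *: x + t *: h) - F (t *: x) - t * 'D_h F (t *: x)).
  by rewrite scalerDr exprS; ring.
apply: weight_le => //.
apply: le_trans (@ray_mvt F x h (e / n.+1%:R) r0 dF _ hr t t01) _.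
  move=> j k s kr; apply: (Hr j).2; apply: lt_le_trans kr _.
  exact: bigmin_le_cond.
apply: ler_wpM2r => //; rewrite -[leLHS]mulr_natr -mulrA.
rewrite ler_piMr ?ltW //.
by rewrite ltr_pdivrMl ?mulr1 ?ltr_nat.
Qed.

Lemma Ck_ray_mean k p F : Ck k setT F -> Ck k setT (ray_mean p F).
Proof.
elim: k p F => [|k IH] p F.
  move=> cF x _; apply: ray_mean_continuous => y; exact: cF.
move=> CF; have C1 : Ck 1 setT F.
  split=> [x Ux|v]; first by case: CF => + _; exact.
  by case: CF => _ /(_ v) /Ck_continuous H x Ux; exact: H.
split=> [x _|v]; first by have [] := ray_mean_diff p x C1.
apply: Ck_eq (IH p.+1 _ (CF.2 v)) => [|x _]; first exact: openT.
by have [_ ->] := ray_mean_diff p x C1.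
Qed.

Lemma smooth_ray_mean p F : smooth F -> smooth (ray_mean p F).
Proof. by move=> sF k; apply: Ck_ray_mean. Qed.

Lemma ray_FTC F x : smooth F ->
  F x - F 0 = mean (fun t => 'D_x F (t *: x)).
Proof.
move=> sF; have [dF cD] := sF 1.
have cg : continuous (fun t : R => 'D_x F (t *: x)).
  move=> t.
  apply: (@continuous_comp _ _ _ (fun t : R => t *: x) (fun y => 'D_x F y) t).
    exact: scalel_continuous.
  exact: cD.
have dA (t : R) : t \in `[0, 1] ->
    is_derive t 1 (fun t : R => F (0 + t *: x)) ('D_x F (t *: x)).
  move=> t01; have [dl Dl] := affine_path 0 x t.
  have [dc Dc] := differentiable_post dl (dF _ I).
  by apply: DeriveDef; [exact: diff_derivable|rewrite Dc Dl add0r].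
by rewrite (mean_primitive cg dA) scale1r scale0r !add0r.
Qed.

End RayMean.

(** * Complex-valued smooth functions *)

Section ComplexSmooth.
Variables (R : realType) (V : normedModType R).
Local Notation C := R[i].
Implicit Types (U : set V) (f g : V -> C).

Definition csmooth_on U f : Prop :=
  smooth_on U (fun x => complex.Re (f x) : R) /\
  smooth_on U (fun x => complex.Im (f x) : R).

Lemma csmooth_on_sub U f : csmooth f -> csmooth_on U f.
Proof. by move=> [r i]; split=> k; apply: (@Ck_sub _ _ _ _ setT). Qed.

Lemma csmooth_on_eq U f g : open U -> (forall x, U x -> f x = g x) ->
  csmooth_on U f -> csmooth_on U g.
Proof.
move=> oU fg [r i]; split=> k.
  by apply: Ck_eq (r k) => // x Ux; rewrite fg.
by apply: Ck_eq (i k) => // x Ux; rewrite fg.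
Qed.

Lemma csmooth_on_cst U (a : C) : csmooth_on U (fun=> a).
Proof. by split=> k; exact: Ck_cst. Qed.

Lemma csmooth_on_add U f g : open U ->
  csmooth_on U f -> csmooth_on U g -> csmooth_on U (fun x => f x + g x).
Proof.
move=> oU [rf jf] [rg jg]; split=> k.
  by apply: Ck_eq (Ck_add oU (rf k) (rg k)) => // x _ /=; rewrite raddfD.
by apply: Ck_eq (Ck_add oU (jf k) (jg k)) => // x _ /=; rewrite raddfD.
Qed.

Lemma csmooth_on_mul U f g : open U ->
  csmooth_on U f -> csmooth_on U g -> csmooth_on U (fun x => f x * g x).
Proof.
move=> oU [rf jf] [rg jg]; split=> k.
  apply: Ck_eq (Ck_add oU (Ck_mul oU (rf k) (rg k))
    (Ck_opp oU (Ck_mul oU (jf k) (jg k)))) => // x _ /=.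
  by case: (f x) => a b; case: (g x) => c d.
apply: Ck_eq (Ck_add oU (Ck_mul oU (rf k) (jg k))
  (Ck_mul oU (jf k) (rg k))) => // x _ /=.
by case: (f x) => a b; case: (g x) => c d.
Qed.

Lemma csmooth_on_opp U f : open U -> csmooth_on U f ->
  csmooth_on U (fun x => - f x).
Proof.
move=> oU cf; apply: csmooth_on_eq (csmooth_on_mul oU (csmooth_on_cst U (-1)) cf).
  exact: oU.
by move=> x _; rewrite mulN1r.
Qed.

Lemma csmooth_on_sum U (I : Type) (r : seq I) (f : I -> V -> C) : open U ->
  (forall i, csmooth_on U (f i)) -> csmooth_on U (fun x => \sum_(i <- r) f i x).
Proof.
move=> oU Cf; elim: r => [|i r IH].
  apply: csmooth_on_eq (csmooth_on_cst U 0); first exact: oU.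
  by move=> x _; rewrite big_nil.
apply: csmooth_on_eq (csmooth_on_add oU (Cf i) IH); first exact: oU.
by move=> x _; rewrite big_cons.
Qed.

(** The inverse is the conjugate divided by the squared modulus. *)
Lemma csmooth_on_inv U f : open U -> (forall x, U x -> f x != 0) ->
  csmooth_on U f -> csmooth_on U (fun x => (f x)^-1).
Proof.
move=> oU f0 [rf jf].
pose N x := complex.Re (f x) * complex.Re (f x) +
            complex.Im (f x) * complex.Im (f x).
have N0 x : U x -> N x != 0.
  move=> /f0; apply: contra; rewrite /N -!expr2 paddr_eq0 ?sqr_ge0 //.
  by rewrite !sqrf_eq0 eq_complex.
have CN k : Ck k U (fun x => (N x)^-1).
  by apply: Ck_inv => //; apply: Ck_add => //; apply: Ck_mul.
split=> k.
  apply: Ck_eq (Ck_mul oU (rf k) (CN k)) => // x _ /=.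
  by rewrite /N; case: (f x).
apply: Ck_eq (Ck_opp oU (Ck_mul oU (jf k) (CN k))) => // x _ /=.
by rewrite /N; case: (f x).
Qed.

Lemma csmooth_on_cderive U f v : csmooth_on U f ->
  csmooth_on U (fun x => cderive f x v).
Proof.
move=> [rf jf]; split=> k.
  by have [_] := rf k.+1; exact.
by have [_] := jf k.+1; exact.
Qed.

Definition cdiff f x := differentiable (fun y => complex.Re (f y) : R) x /\
  differentiable (fun y => complex.Im (f y) : R) x.

Lemma csmooth_on_cdiff U f x : csmooth_on U f -> U x -> cdiff f x.
Proof.
move=> [rf jf] Ux; split.
  by have [+ _] := rf 1; exact.
by have [+ _] := jf 1; exact.
Qed.

Lemma cderive_add f g x v : cdiff f x -> cdiff g x ->
  cderive (fun y => f y + g y) x v = cderive f x v + cderive g x v.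
Proof.
move=> [rf jf] [rg jg]; rewrite /cderive.
under eq_fun do rewrite raddfD.
under [X in _ +i* 'D_v X x]eq_fun do rewrite raddfD.
by rewrite !deriveD //; exact: diff_derivable.
Qed.

Lemma Re_mul f g : (fun y => complex.Re (f y * g y) : R) =
  (fun y => complex.Re (f y)) * (fun y => complex.Re (g y)) -
  (fun y => complex.Im (f y)) * (fun y => complex.Im (g y)).
Proof.
by apply/funext => y; rewrite !fctE; case: (f y) => ? ?; case: (g y).
Qed.

Lemma Im_mul f g : (fun y => complex.Im (f y * g y) : R) =
  (fun y => complex.Re (f y)) * (fun y => complex.Im (g y)) +
  (fun y => complex.Im (f y)) * (fun y => complex.Re (g y)).
Proof.
by apply/funext => y; rewrite !fctE; case: (f y) => ? ?; case: (g y).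
Qed.

Lemma cderive_mul f g x v : cdiff f x -> cdiff g x ->
  cderive (fun y => f y * g y) x v = cderive f x v * g x + f x * cderive g x v.
Proof.
move=> [rf jf] [rg jg]; rewrite /cderive Re_mul Im_mul.
have drf := @diff_derivable _ _ _ _ _ v rf.
have djf := @diff_derivable _ _ _ _ _ v jf.
have drg := @diff_derivable _ _ _ _ _ v rg.
have djg := @diff_derivable _ _ _ _ _ v jg.
rewrite (deriveB (derivableM drf drg) (derivableM djf djg)).
rewrite (deriveD (derivableM drf djg) (derivableM djf drg)).
rewrite (deriveM drf drg) (deriveM djf djg) (deriveM drf djg) (deriveM djf drg).
rewrite /GRing.scale /=.
move: ('D_v (fun y => complex.Re (f y) : R) x) => rf'.
move: ('D_v (fun y => complex.Im (f y) : R) x) => jf'.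
move: ('D_v (fun y => complex.Re (g y) : R) x) => rg'.
move: ('D_v (fun y => complex.Im (g y) : R) x) => jg'.
case: (f x) => a b; case: (g x) => c d /=.
by apply/eqP; rewrite eq_complex /=; apply/andP; split; apply/eqP; ring.
Qed.

Lemma cderive_cst (a : C) (x v : V) : cderive (fun=> a) x v = 0.
Proof. by rewrite /cderive !derive_cst. Qed.

Lemma cderive_opp f x v : cdiff f x ->
  cderive (fun y => - f y) x v = - cderive f x v.
Proof.
move=> cf; have -> : (fun y => - f y) = (fun y => -1 * f y).
  by apply/funext => y; rewrite mulN1r.
have c1 : cdiff (fun=> -1 : C) x by split; exact: differentiable_cst.
by rewrite (cderive_mul v c1 cf) cderive_cst mul0r add0r mulN1r.
Qed.

Lemma derive_lin (F : V -> R) x (a b : R) u v : differentiable F x ->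
  'D_(a *: u + b *: v) F x = a * 'D_u F x + b * 'D_v F x.
Proof.
by move=> dF; rewrite (deriveE _ dF) linearD !linearZ -!(deriveE _ dF).
Qed.

Lemma cderive_lin f x (a b : R) u v : cdiff f x ->
  cderive f x (a *: u + b *: v) = a%:C * cderive f x u + b%:C * cderive f x v.
Proof.
move=> [rf jf]; rewrite /cderive (derive_lin _ _ _ _ rf) (derive_lin _ _ _ _ jf).
move: ('D_u _ _) ('D_v _ _) ('D_u _ _) ('D_v _ _) => p q r s.
by apply/eqP; rewrite eq_complex /= !mul0r !subr0 !addr0 !eqxx.
Qed.

Lemma cdiff_mul f g x : cdiff f x -> cdiff g x ->
  cdiff (fun y => f y * g y) x.
Proof.
move=> [rf jf] [rg jg]; split; rewrite ?Re_mul ?Im_mul.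
  by apply: differentiableB; exact: differentiableM.
by apply: differentiableD; exact: differentiableM.
Qed.

Lemma cdiff_sum (I : Type) (r : seq I) (f : I -> V -> C) x :
  (forall i, cdiff (f i) x) -> cdiff (fun y => \sum_(i <- r) f i y) x /\
  forall v, cderive (fun y => \sum_(i <- r) f i y) x v =
            \sum_(i <- r) cderive (f i) x v.
Proof.
move=> df; elim: r => [|i r [IH1 IH2]].
  split; last by move=> v; rewrite big_nil; under eq_fun do rewrite big_nil;
    exact: cderive_cst.
  by split; under eq_fun do rewrite big_nil; exact: differentiable_cst.
have -> : (fun y => \sum_(j <- i :: r) f j y) =
          (fun y => f i y + \sum_(j <- r) f j y).
  by apply/funext => y; rewrite big_cons.
split; last by move=> v; rewrite cderive_add // big_cons IH2.
split; under eq_fun do rewrite raddfD.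
  by apply: differentiableD; [case: (df i)|case: IH1].
by apply: differentiableD; [case: (df i)|case: IH1].
Qed.

End ComplexSmooth.

Section ComplexSmoothC2.
Variables (R : realType).
Local Notation C := R[i].

Lemma csmooth_on_comp (V : normedModType R) (U : set V) (F : C2 R -> C)
    (g : V -> C2 R) : open U -> csmooth F -> smooth_on U g ->
  csmooth_on U (F \o g).
Proof.
move=> oU [rF jF] Cg; split=> k.
  exact: (@Ck_comp _ _ k _ U setT (fun y => complex.Re (F y) : R) g).
exact: (@Ck_comp _ _ k _ U setT (fun y => complex.Im (F y) : R) g).
Qed.

Lemma csmooth_wc : csmooth (@wc R).
Proof.
by split=> k; apply: (@Ck_coord _ _ k 4 setT id) => //; exact: openT || exact: Ck_id.
Qed.

Lemma csmooth_zc : csmooth (@zc R).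
Proof.
by split=> k; apply: (@Ck_coord _ _ k 4 setT id) => //; exact: openT || exact: Ck_id.
Qed.

Lemma smooth_on_mkC2 (V : normedModType R) (U : set V) (a b : V -> C) :
  open U -> csmooth_on U a -> csmooth_on U b ->
  smooth_on U (fun x => mkC2 (a x) (b x)).
Proof.
move=> oU [ra ja] [rb jb] k; apply: Ck_rV => // j.
have := (ra k, ja k, rb k, jb k) => -[[[Ca Ca'] Cb] Cb'].
case: j => [[|[|[|[|//]]]]] ?; [move: Ca|move: Ca'|move: Cb|move: Cb'].
all: by apply: Ck_eq => // x _; rewrite mxE.
Qed.

Lemma cdiff_wc (x : C2 R) : cdiff (@wc R) x.
Proof. exact: csmooth_on_cdiff csmooth_wc I. Qed.

Lemma cdiff_zc (x : C2 R) : cdiff (@zc R) x.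
Proof. exact: csmooth_on_cdiff csmooth_zc I. Qed.

Lemma cderive_comp (V : normedModType R) (F : C2 R -> C) (g : V -> C2 R) x v :
  differentiable g x -> cdiff F (g x) ->
  cderive (F \o g) x v = cderive F (g x) ('D_v g x).
Proof.
move=> dg [rF jF]; rewrite /cderive; congr (_ +i* _).
  by have [_] := differentiable_post dg rF; exact.
by have [_] := differentiable_post dg jF; exact.
Qed.

Lemma derive_coord (V : normedModType R) n (g : V -> 'rV[R]_n) x v j :
  differentiable g x -> 'D_v (fun y => g y 0 j : R) x = 'D_v g x 0 j.
Proof.
move=> dg; have [||_] := @linear_post_differentiable _ _ _ _
  (fun M : 'rV[R]_n => M 0 j : R) g x _ _ dg; last exact.
- by move=> a M N; rewrite !mxE.
- exact: coord_continuous.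
Qed.

Lemma cderive_wc (V : normedModType R) (g : V -> C2 R) x v :
  differentiable g x -> cderive (fun y => wc (g y)) x v = wc ('D_v g x).
Proof. by move=> dg; rewrite /cderive /wc /= !derive_coord. Qed.

Lemma cderive_zc (V : normedModType R) (g : V -> C2 R) x v :
  differentiable g x -> cderive (fun y => zc (g y)) x v = zc ('D_v g x).
Proof. by move=> dg; rewrite /cderive /zc /= !derive_coord. Qed.

Lemma cderive_wc_id (x v : C2 R) : cderive (@wc R) x v = wc v.
Proof. by rewrite (@cderive_wc _ id) ?derive_id. Qed.

Lemma cderive_zc_id (x v : C2 R) : cderive (@zc R) x v = zc v.
Proof. by rewrite (@cderive_zc _ id) ?derive_id. Qed.

Lemma cderive_sum (f : C2 R -> C) x v : cdiff f x ->
  cderive f x v = \sum_j (v 0 j)%:C * cderive f x 'e_j.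
Proof.
move=> [rf jf]; rewrite /cderive (derive_rV_sum _ rf) (derive_rV_sum _ jf).
rewrite [RHS](_ : _ = complex.Re (\sum_j (v 0 j)%:C *
  cderive f x 'e_j) +i* complex.Im (\sum_j (v 0 j)%:C * cderive f x 'e_j)).
  rewrite !raddf_sum; congr (_ +i* _); apply: eq_bigr => j _ /=; ring.
by rewrite /cderive; case: (\sum_j _).
Qed.

Lemma smooth_differentiable (V W : normedModType R) (g : V -> W) x :
  smooth g -> differentiable g x.
Proof. by move=> sg; have [+ _] := sg 1; exact. Qed.

Lemma csmooth_on_coord (V : normedModType R) (U : set V) (g : V -> C2 R) j :
  open U -> smooth_on U g -> csmooth_on U (fun x => (g x 0 j)%:C).
Proof.
move=> oU sg; split=> k; first exact: Ck_coord (sg k).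
exact: (@Ck_cst _ _ k _ U (0 : R)).
Qed.

Lemma cderive_coord (V : normedModType R) (g : V -> C2 R) j x v :
  differentiable g x -> cderive (fun x => (g x 0 j)%:C) x v = ('D_v g x 0 j)%:C.
Proof. by move=> dg; rewrite /cderive /= derive_cst derive_coord. Qed.

Lemma cdiff_coord (V : normedModType R) (g : V -> C2 R) j x :
  differentiable g x -> cdiff (fun x => (g x 0 j)%:C) x.
Proof.
move=> dg; split; last exact: differentiable_cst.
have [||] := @linear_post_differentiable _ _ _ _
  (fun M : 'rV[R]_4 => M 0 j : R) g x _ _ dg; last by [].
- by move=> a M N; rewrite !mxE.
- exact: coord_continuous.
Qed.

End ComplexSmoothC2.

(** * Exterior products in low degrees *)

Local Close Scope classical_set_scope.
Local Open Scope set_scope.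
Section ExteriorAlgebra.
Variable R : realType.
Local Notation C := R[i].
Implicit Types (a b : ext R) (L : 'M[R]_4).

Lemma extP a b : (forall k A, a k A = b k A) -> a = b.
Proof.
by move=> ab; apply: functional_extensionality_dep => k; apply/funext => A.
Qed.

(** Degrees such as the cardinal of a set of positions are only provably equal
    to numerals; evaluations are transported along such equalities. *)
Lemma ext_cast a k k' (e : k = k') (A : 'M[R]_(k, 4)) (A' : 'M[R]_(k', 4)) :
  (forall i j, A i j = A' (cast_ord e i) j) -> a k A = a k' A'.
Proof.
subst k' => H; congr (a k _); apply/matrixP => i j; rewrite H.
by congr (A' _ _); apply: val_inj.
Qed.

Lemma ext_deg0 a k (A : 'M[R]_(k, 4)) (A' : 'M[R]_(0, 4)) :
  k = 0%N -> a k A = a 0%N A'.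
Proof. by move=> e; apply: (ext_cast _ (e := e)) => i; case: (cast_ord e i). Qed.

Lemma wedge_pull L a b :
  wedge (ext_pull L a) (ext_pull L b) = ext_pull L (wedge a b).
Proof.
apply: extP => k A; rewrite /wedge /ext_pull; apply: eq_bigr => S _.
by rewrite !mul_rowsub_mx.
Qed.

Lemma wedge_scaler c a b : wedge a (ext_scale c b) = ext_scale c (wedge a b).
Proof.
apply: extP => k A; rewrite /wedge /ext_scale mulr_sumr.
by apply: eq_bigr => S _; ring.
Qed.

Lemma ext_scaleA c d a : ext_scale c (ext_scale d a) = ext_scale (c * d) a.
Proof. by apply: extP => k A; rewrite /ext_scale mulrA. Qed.

Lemma ext_exp_pull L a : ext_exp (ext_pull L a) = ext_pull L (ext_exp a).
Proof. by rewrite /ext_exp wedge_pull. Qed.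

Lemma wedge_deg0 a b (A : 'M[R]_(0, 4)) : wedge a b 0%N A = a 0%N A * b 0%N A.
Proof.
rewrite /wedge (big_pred1 (finset.set0 : {set 'I_0})).
  rewrite (ext_deg0 a _ A) ?cards0 //.
  rewrite (ext_deg0 b _ A) ?(finset.setC0, cardsT, card_ord) //.
  rewrite /shuffle_sign eq_card0 ?expr0 ?mul1r // => -[[]] //.
by move=> S; apply/esym/eqP/finset.setP => -[].
Qed.

Lemma ext_rowsub_setT a m (S : {set 'I_m}) (A : 'M[R]_(m, 4)) : S = finset.setT ->
  a #|S| (rowsub (@enum_val _ (mem S)) A) = a m A.
Proof.
move=> ->; have e : #|[set: 'I_m]| = m by rewrite cardsT card_ord.
apply: (ext_cast _ (e := e)) => i j; rewrite !mxE; congr (A _ _).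
apply: val_inj => /=.
rewrite (enum_val_nth (cast_ord e i)) /= -[X in nth _ X _]/(enum [set: 'I_m]).
by rewrite enum_setT -enumT nth_enum_ord // -[X in (_ < X)%N]e.
Qed.

Lemma ext_rowsub_set1 a m (S : {set 'I_m}) i (A : 'M[R]_(m, 4)) :
  S = [set i] -> a #|S| (rowsub (@enum_val _ (mem S)) A) = a 1%N (row i A).
Proof.
move=> ->; apply: (ext_cast _ (e := cards1 i)) => k j; rewrite !mxE.
by congr (A _ _); have := enum_valP k; rewrite inE => /eqP.
Qed.

(** A subset of a pair amounts to two booleans. *)
Lemma big_set2 (F : {set 'I_2} -> C) :
  \sum_(S : {set 'I_2}) F S =
  F finset.set0 + F finset.setT + (F [set ord0] + F [set ord_max]).
Proof.
pose f (p : bool * bool) := [set i : 'I_2 | if i == ord0 then p.1 else p.2].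
rewrite (reindex f) /=; last first.
  exists (fun S : {set 'I_2} => (ord0 \in S, ord_max \in S)) => [[p q] _|S _].
    by rewrite /f !inE.
  by apply/finset.setP => -[[|[|//]] ?]; rewrite inE /=; congr (_ \in S); apply: val_inj.
rewrite -(pair_bigA _ (fun p q => F (f (p, q)))) /= !big_bool /=.
have -> : f (true, true) = finset.setT by apply/finset.setP => i; rewrite !inE; case: eqP.
have -> : f (false, false) = finset.set0 by apply/finset.setP => i; rewrite !inE; case: eqP.
have -> : f (true, false) = [set ord0].
  by apply/finset.setP => i; rewrite !inE; case: eqP.
have -> : f (false, true) = [set ord_max].
  by apply/finset.setP => -[[|[|//]] ?]; rewrite !inE.
by ring.
Qed.

(** The four sets of positions give the four terms, and only the one that
    feeds the second vector first contains an inversion. *)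
Lemma wedge_deg2 a b (A : 'M[R]_(2, 4)) (Z : 'M[R]_(0, 4)) :
  wedge a b 2%N A = a 0%N Z * b 2%N A + a 2%N A * b 0%N Z +
    (a 1%N (row ord0 A) * b 1%N (row ord_max A) -
     a 1%N (row ord_max A) * b 1%N (row ord0 A)).
Proof.
have C0 : ~: [set ord0] = [set ord_max] :> {set 'I_2}.
  by apply/finset.setP => -[[|[|//]] ?]; rewrite !inE.
have C1 : ~: [set ord_max] = [set ord0] :> {set 'I_2}.
  by apply/finset.setP => -[[|[|//]] ?]; rewrite !inE.
have CT : #|~: finset.setT : {set 'I_2}| = 0%N by rewrite finset.setCT cards0.
rewrite /wedge big_set2.
rewrite (ext_deg0 a _ Z (cards0 _)) (ext_rowsub_setT b _ (finset.setC0 _)).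
rewrite (ext_rowsub_setT a _ (erefl finset.setT)).
rewrite (ext_deg0 b _ Z CT).
rewrite (ext_rowsub_set1 a _ (erefl [set ord0])) (ext_rowsub_set1 b _ C0).
rewrite (ext_rowsub_set1 a _ (erefl [set ord_max])) (ext_rowsub_set1 b _ C1).
have -> : shuffle_sign R (finset.set0 : {set 'I_2}) = 1.
  by rewrite /shuffle_sign eq_card0 // => -[i j]; rewrite !inE.
have -> : shuffle_sign R (finset.setT : {set 'I_2}) = 1.
  by rewrite /shuffle_sign eq_card0 // => -[i j]; rewrite !inE.
have -> : shuffle_sign R ([set ord0] : {set 'I_2}) = 1.
  rewrite /shuffle_sign eq_card0 // => -[i j]; rewrite !inE /=.
  by case: eqP => // ->; rewrite ltn0 andbF.
have -> : shuffle_sign R ([set ord_max] : {set 'I_2}) = -1.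
  rewrite /shuffle_sign (@fintype.eq_card1 _ (ord_max, ord0)) ?expr1 // => -[i j].
  by rewrite !inE xpair_eqE; case: i j => [[|[|//]] ?] [[|[|//]] ?].
by ring.
Qed.

Lemma wedge_neq2 a b m (A : 'M[R]_(m, 4)) : m <> 2%N ->
  (forall k A', k <> 1%N -> a k A' = 0) ->
  (forall k A', k <> 1%N -> b k A' = 0) -> wedge a b m A = 0.
Proof.
move=> m2 a0 b0; rewrite /wedge big1 // => S _.
have [S1|S1] := eqVneq #|S| 1%N; last first.
  by rewrite a0 ?mulr0 ?mul0r //; exact/eqP.
rewrite b0 ?mulr0 // => S2; apply: m2.
by rewrite -(card_ord m) -cardsT -(finset.setUCr S) cardsU finset.setICr cards0 S1 S2.
Qed.

Lemma wedge_low2 b m (A : 'M[R]_(m, 4)) : (m < 4)%N ->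
  (forall k A', k <> 2%N -> b k A' = 0) -> wedge b b m A = 0.
Proof.
move=> m4 b0; rewrite /wedge big1 // => S _.
have [S2|S2] := eqVneq #|S| 2%N; last first.
  by rewrite b0 ?mulr0 ?mul0r //; exact/eqP.
rewrite (b0 #|~: S|) ?mulr0 // => S2'; move: m4.
by rewrite -(card_ord m) -cardsT -(finset.setUCr S) cardsU finset.setICr cards0 S2 S2'.
Qed.

(** The square of a 2-form lives in degree 4. *)
Lemma ext_exp_low b k (A : 'M[R]_(k, 4)) : (k < 4)%N ->
  (forall k A', k <> 2%N -> b k A' = 0) -> ext_exp b k A = (k == 0%N)%:R + b k A.
Proof.
move=> k4 b0; rewrite /ext_exp /ext_add /ext_scale wedge_low2 // mulr0 addr0.
by [].
Qed.

Lemma wedge_exp_deg2 b a (A : 'M[R]_(2, 4)) Z :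
  (forall k A', k <> 2%N -> b k A' = 0) ->
  wedge (ext_exp b) a 2%N A = a 2%N A + b 2%N A * a 0%N Z.
Proof.
move=> b0; rewrite (wedge_deg2 _ _ _ Z) !ext_exp_low //.
rewrite (b0 0%N) // !(b0 1%N) // !addr0 /= mul1r !add0r.
by rewrite !mul0r subr0 addr0.
Qed.

Lemma wedge_exp_deg0 b a (Z : 'M[R]_(0, 4)) :
  (forall k A', k <> 2%N -> b k A' = 0) -> wedge (ext_exp b) a 0%N Z = a 0%N Z.
Proof.
by move=> b0; rewrite wedge_deg0 ext_exp_low // b0 // addr0 mul1r.
Qed.

Lemma extd_form0 (f : C2 R -> C) x (A : 'M[R]_(1, 4)) :
  extd (form0 f) x 1%N A = cderive f x (row ord0 A).
Proof. by rewrite /extd big_ord1 expr0 mul1r. Qed.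

Lemma extd_form0_neq1 (f : C2 R -> C) x k (A : 'M[R]_(k, 4)) : k <> 1%N ->
  extd (form0 f) x k A = 0.
Proof.
case: k A => [//|[//|k]] A _; rewrite /extd big1 // => i _.
by rewrite cderive_cst mulr0.
Qed.

Lemma dw_dz_neq2 (x : C2 R) k (A : 'M[R]_(k, 4)) : k <> 2%N -> dw_dz x k A = 0.
Proof.
by move=> k2; apply: wedge_neq2 => // k' A'; exact: extd_form0_neq1.
Qed.

Lemma dw_dz_deg2 (x : C2 R) (A : 'M[R]_(2, 4)) : dw_dz x 2%N A =
  wc (row ord0 A) * zc (row ord_max A) - wc (row ord_max A) * zc (row ord0 A).
Proof.
rewrite /dw_dz (wedge_deg2 _ _ _ 0) !(@extd_form0_neq1 _ _ 0) //.
rewrite !(@extd_form0_neq1 _ _ 2) // !mul0r !add0r !extd_form0.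
have rr (i : 'I_2) : row ord0 (row i A) = row i A.
  by apply/rowP => j; rewrite !mxE.
by rewrite !rr !cderive_wc_id !cderive_zc_id.
Qed.

End ExteriorAlgebra.
Local Close Scope set_scope.
Local Open Scope classical_set_scope.

(** * Pullback of two-forms *)

Section Jacobian.
Variable R : realType.
Implicit Types (f g h : C2 R -> C2 R).

Lemma row_jacobian k (A : 'M[R]_(k, 4)) f x i : differentiable f x ->
  row i (A *m 'J f x) = 'D_(row i A) f x.
Proof. by move=> df; rewrite row_mul deriveEjacobian. Qed.

Lemma jacobian_chain f g h x : differentiable f x -> differentiable g x ->
  differentiable h (g x) -> (\forall y \near x, h (g y) = f y) ->
  'J f x = 'J g x *m 'J h (g x).
Proof.
move=> df dg dh e; apply/row_matrixP => i.
have [dc Dc] := differentiable_post dg dh.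
have Ef := deriveEjacobian 'e_i df; have Eg := deriveEjacobian 'e_i dg.
have Eh := deriveEjacobian ('D_('e_i) g x) dh.
apply: etrans (rowE _ _) _; apply: etrans _ (esym (row_mul _ _ _)).
have -> : row i ('J g x) = 'D_('e_i) g x by exact: etrans (rowE _ _) (esym Eg).
rewrite -Ef -Eh -Dc; apply: near_eq_derive.
by apply: filterS e => y <-.
Qed.

(** The factorisation is only required near x, so that local expressions of
    maps between charts can be used. *)
Lemma pullback_chain (omega : dform R) f g h x :
  differentiable f x -> differentiable g x ->
  differentiable h (g x) -> (\forall y \near x, h (g y) = f y) ->
  pullback f omega x = ext_pull ('J g x) (pullback h omega (g x)).
Proof.
move=> df dg dh e; apply: extP => k A.
rewrite /pullback /ext_pull (jacobian_chain df dg dh e) mulmxA.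
by rewrite (nbhs_singleton e).
Qed.

End Jacobian.

Section TwoForms.
Variable R : realType.
Local Notation C := R[i].
Local Notation E2 := (C2 R).

Definition mx2 (u v : E2) : 'M[R]_(2, 4) :=
  \matrix_(i < 2) if i == ord0 then u else v.

Lemma mx2_row (A : 'M[R]_(2, 4)) : A = mx2 (row ord0 A) (row ord_max A).
Proof.
by apply/row_matrixP => -[[|[|//]] ?]; rewrite rowK /=;
  congr (row _ A); apply: val_inj.
Qed.

Lemma row0_mx2 u v : row ord0 (mx2 u v) = u.
Proof. by rewrite rowK. Qed.

Lemma row1_mx2 u v : row ord_max (mx2 u v) = v.
Proof. by rewrite rowK. Qed.

Section Bilinear.
Variable a : 'M[R]_(2, 4) -> C.
Hypothesis alt_a : is_alternating a.

Lemma row'_mx2 (i : 'I_2) u v u' v' :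
  (if i == ord0 then v else u) = (if i == ord0 then v' else u') ->
  row' i (mx2 u v) = row' i (mx2 u' v').
Proof.
move=> e; apply/matrixP => k j; rewrite !mxE.
by move: e; case: i k => [[|[|//]] ?] [[|//] ?] /= ->.
Qed.

Lemma alt2_linl (b c : R) u u1 u2 v :
  u = b *: u1 + c *: u2 ->
  a (mx2 u v) = b%:C * a (mx2 u1 v) + c%:C * a (mx2 u2 v).
Proof.
move=> e; apply: (alt_a.1 ord0); first by rewrite !row0_mx2.
  exact: row'_mx2.
exact: row'_mx2.
Qed.

Lemma alt2_linr (b c : R) u v v1 v2 :
  v = b *: v1 + c *: v2 ->
  a (mx2 u v) = b%:C * a (mx2 u v1) + c%:C * a (mx2 u v2).
Proof.
move=> e; apply: (alt_a.1 ord_max); first by rewrite !row1_mx2.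
  exact: row'_mx2.
exact: row'_mx2.
Qed.

Lemma alt2_diag u : a (mx2 u u) = 0.
Proof. by apply: (alt_a.2 _ ord0 ord_max) => //; rewrite row0_mx2 row1_mx2. Qed.

Lemma alt2_anti u v : a (mx2 u v) = - a (mx2 v u).
Proof.
have := alt2_diag (u + v); rewrite (@alt2_linl 1 1 _ u v); last by rewrite !scale1r.
rewrite (@alt2_linr 1 1 u _ u v); last by rewrite !scale1r.
rewrite (@alt2_linr 1 1 v _ u v); last by rewrite !scale1r.
rewrite !alt2_diag !mul1r add0r addr0 => /eqP.
by rewrite addr_eq0 => /eqP.
Qed.

Lemma alt2_sumr u v :
  a (mx2 u v) = \sum_j (v 0 j)%:C * a (mx2 u 'e_j).
Proof.
have a0 : a (mx2 u 0) = 0.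
  rewrite (@alt2_linr 0 0 u 0 0 0) ?mul0r ?addr0 //.
  by rewrite !scale0r addr0.
rewrite {1}[v]row_sum_delta.
elim: (index_enum 'I_4) => [|j s IH]; first by rewrite !big_nil.
rewrite !big_cons -IH (@alt2_linr (v 0 j) 1 _ _ 'e_j (\sum_(i <- s) v 0 i *: 'e_i)).
  by rewrite mul1r.
by rewrite scale1r.
Qed.

Lemma alt2_suml u v :
  a (mx2 u v) = \sum_i (u 0 i)%:C * a (mx2 'e_i v).
Proof.
rewrite alt2_anti alt2_sumr -sumrN; apply: eq_bigr => i _.
by rewrite [a (mx2 v _)]alt2_anti mulrN opprK.
Qed.

Lemma alt2_expand u v : a (mx2 u v) =
  \sum_i \sum_j (u 0 i)%:C * ((v 0 j)%:C * a (mx2 'e_i 'e_j)).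
Proof.
rewrite alt2_suml; apply: eq_bigr => i _.
by rewrite alt2_sumr mulr_sumr.
Qed.

End Bilinear.

Lemma alt2_scaler a (t : R) u v : is_alternating a ->
  a (mx2 u (t *: v)) = t%:C * a (mx2 u v).
Proof.
move=> aa; rewrite (@alt2_linr a aa t 0 u _ v v) ?scale0r ?addr0 //.
by rewrite (_ : 0%:C = 0) // mul0r addr0.
Qed.

Lemma csmooth_on_form2 (B : dform R) (V : normedModType R) (U : set V)
    (f X Y : V -> E2) : is_form B -> open U ->
  smooth_on U f -> smooth_on U X -> smooth_on U Y ->
  csmooth_on U (fun x => B (f x) 2%N (mx2 (X x) (Y x))).
Proof.
move=> formB oU sf sX sY.
apply: (@csmooth_on_eq _ _ _ (fun x => \sum_i \sum_j
  (X x 0 i)%:C * ((Y x 0 j)%:C * B (f x) 2%N (mx2 'e_i 'e_j)))) => //.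
  by move=> x _; rewrite [RHS]alt2_expand //; exact: formB.1.
apply: csmooth_on_sum => // i; apply: csmooth_on_sum => // j.
apply: csmooth_on_mul => //; first exact: csmooth_on_coord.
apply: csmooth_on_mul => //; first exact: csmooth_on_coord.
exact: (@csmooth_on_comp _ _ _ (fun z => B z 2%N (mx2 'e_i 'e_j)) f oU
  (formB.2 _ _) sf).
Qed.

(** In coordinates the left-hand side is a sum of products of functions, so
    this is an instance of the Leibniz rule. *)
Lemma cderive_form2 (B : dform R) (f X Y : E2 -> E2) x v : is_form B ->
  differentiable f x -> differentiable X x -> differentiable Y x ->
  cderive (fun y => B (f y) 2%N (mx2 (X y) (Y y))) x v =
  cderive (fun z => B z 2%N (mx2 (X x) (Y x))) (f x) ('D_v f x) +
  B (f x) 2%N (mx2 ('D_v X x) (Y x)) + B (f x) 2%N (mx2 (X x) ('D_v Y x)).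
Proof.
move=> formB df dX dY.
have cB i j : cdiff (fun z => B z 2%N (mx2 'e_i 'e_j)) (f x).
  exact: csmooth_on_cdiff (formB.2 2%N _) I.
have cBf i j : cdiff (fun y => B (f y) 2%N (mx2 'e_i 'e_j)) x.
  have [r c] := cB i j; split.
    by have [] := differentiable_post df r.
  by have [] := differentiable_post df c.
have E1 : (fun y => B (f y) 2%N (mx2 (X y) (Y y))) = (fun y => \sum_i \sum_j
    (X y 0 i)%:C * ((Y y 0 j)%:C * B (f y) 2%N (mx2 'e_i 'e_j))).
  by apply/funext => y; rewrite alt2_expand //; exact: formB.1.
have E2' : (fun z => B z 2%N (mx2 (X x) (Y x))) = (fun z => \sum_i \sum_j
    (X x 0 i)%:C * ((Y x 0 j)%:C * B z 2%N (mx2 'e_i 'e_j))).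
  by apply/funext => y; rewrite alt2_expand //; exact: formB.1.
have cX i := cdiff_coord i dX; have cY i := cdiff_coord i dY.
have c1 i j := cdiff_mul (cX i) (cdiff_mul (cY j) (cBf i j)).
have c2 i := (@cdiff_sum _ _ _ (index_enum 'I_4) _ _ (c1 i)).
rewrite E1 (cdiff_sum (index_enum 'I_4) (fun i => (c2 i).1)).2.
have ccst (c : C) : cdiff (fun=> c) (f x) by split; exact: differentiable_cst.
have d1 i j := cdiff_mul (ccst (X x 0 i)%:C)
  (cdiff_mul (ccst (Y x 0 j)%:C) (cB i j)).
have d2 i := (@cdiff_sum _ _ _ (index_enum 'I_4) _ _ (d1 i)).
rewrite E2' (cdiff_sum (index_enum 'I_4) (fun i => (d2 i).1)).2.
rewrite [B (f x) 2%N (mx2 ('D_v X x) _)]alt2_expand; last exact: formB.1.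
rewrite [B (f x) 2%N (mx2 (X x) _)]alt2_expand; last exact: formB.1.
rewrite -!big_split; apply: eq_bigr => i _ /=.
rewrite (c2 i).2 (d2 i).2.
rewrite -!big_split; apply: eq_bigr => j _ /=.
rewrite (cderive_mul v (cX i) (cdiff_mul (cY j) (cBf i j))).
rewrite (cderive_mul v (cY j) (cBf i j)).
rewrite !cderive_coord //.
rewrite (cderive_mul _ (ccst _) (cdiff_mul (ccst _) (cB i j))).
rewrite (cderive_mul _ (ccst _) (cB i j)) !cderive_cst.
rewrite (@cderive_comp _ _ (fun z => B z 2%N (mx2 'e_i 'e_j)) f) //.
ring.
Qed.

End TwoForms.

Section PullbackClosed.
Variable R : realType.
Local Notation C := R[i].
Local Notation E2 := (C2 R).
Implicit Types (f : E2 -> E2) (B omega : dform R).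

Local Notation i0 := (ord0 : 'I_3).
Local Notation i1 := (lift ord0 ord0 : 'I_3).
Local Notation i2 := (lift ord0 (lift ord0 ord0) : 'I_3).

Lemma extd_deg3 omega x (A : 'M[R]_(3, 4)) : extd omega x 3%N A =
  cderive (fun y => omega y 2%N (mx2 (row i1 A) (row i2 A))) x (row i0 A) -
  cderive (fun y => omega y 2%N (mx2 (row i0 A) (row i2 A))) x (row i1 A) +
  cderive (fun y => omega y 2%N (mx2 (row i0 A) (row i1 A))) x (row i2 A).
Proof.
have rowE (i : 'I_3) : row' i A =
    mx2 (row (lift i ord0) A) (row (lift i ord_max) A).
  apply/matrixP => -[[|[|//]] ?] j; rewrite !mxE /= ?mxE; congr (A _ j);
    exact: val_inj.
rewrite /extd !big_ord_recl big_ord0 !rowE.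
have -> : lift i0 ord_max = i2 by exact: val_inj.
have -> : lift i1 ord0 = i0 by exact: val_inj.
have -> : lift i1 ord_max = i2 by exact: val_inj.
have -> : lift i2 ord0 = i0 by exact: val_inj.
have -> : lift i2 ord_max = i1 by exact: val_inj.
rewrite /= /bump /= expr0 expr1 sqrrN expr1n; ring.
Qed.

Lemma extd_zero omega x k (A : 'M[R]_(k.+1, 4)) :
  (forall y A', omega y k A' = 0) -> extd omega x k.+1 A = 0.
Proof.
move=> o0; rewrite /extd big1 // => i _.
by under eq_fun do rewrite o0; rewrite cderive_cst mulr0.
Qed.

Lemma pullback_mx2 f B x (u v : E2) : differentiable f x ->
  pullback f B x 2%N (mx2 u v) = B (f x) 2%N (mx2 ('D_u f x) ('D_v f x)).
Proof.
move=> df; rewrite /pullback /ext_pull; congr (B _ _ _).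
rewrite [LHS]mx2_row; congr mx2.
  by rewrite (row_jacobian (mx2 u v) ord0 df) row0_mx2.
by rewrite (row_jacobian (mx2 u v) ord_max df) row1_mx2.
Qed.

Lemma pullback_alternating f B x k : is_alternating (B (f x) k) ->
  is_alternating (pullback f B x k).
Proof.
have row'M (i : 'I_k) (A : 'M[R]_(k, 4)) (L : 'M[R]_4) :
    row' i (A *m L) = row' i A *m L.
  by apply/matrixP => a b; rewrite !mxE; apply: eq_bigr => c _; rewrite !mxE.
move=> [lin alt]; split => [i b c A A1 A2 e e1 e2|A i j ij e].
  apply: (lin i); last 2 first.
  - by rewrite !row'M e1.
  - by rewrite !row'M e2.
  by rewrite !row_mul e mulmxDl -!scalemxAl.
by apply: (alt _ i j ij); rewrite !row_mul e.
Qed.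

(** Here p, q, r are the first derivatives of a map in three directions and
    pq, pr, qr the mixed second ones. The terms containing second derivatives
    cancel in pairs, since these are symmetric and a is antisymmetric. *)
Lemma alternating_cancel (a : 'M[R]_(2, 4) -> C) (p q r pq qp pr rp qr rq : E2)
    (c1 c2 c3 : C) : is_alternating a -> qp = pq -> rp = pr -> rq = qr ->
  c1 - c2 + c3 = 0 ->
  c1 + a (mx2 pq r) + a (mx2 q pr) - (c2 + a (mx2 qp r) + a (mx2 p qr)) +
    (c3 + a (mx2 rp q) + a (mx2 p rq)) = 0.
Proof.
move=> alt -> -> -> c0; rewrite (alt2_anti alt q pr) -[RHS]c0; ring.
Qed.

(** Exterior differentiation commutes with pullback: the first derivatives of
    f feed dB, and [alternating_cancel] disposes of the second derivatives. *)
Lemma pullback_real_closed f B : smooth f ->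
  (forall u v x, 'D_u (fun y => 'D_v f y) x = 'D_v (fun y => 'D_u f y) x) ->
  real_closed_2form B -> real_closed_2form (pullback f B).
Proof.
move=> sf symf [formB B2 realB closB].
have df x : differentiable f x by exact: smooth_differentiable.
have sDf v : smooth (fun y => 'D_v f y) by move=> k; exact: (sf k.+1).2.
have dDf v x : differentiable (fun y => 'D_v f y) x.
  exact: smooth_differentiable (sDf v).
have P2 x k A : k <> 2%N -> pullback f B x k A = 0 by exact: B2.
split => [|//|x k A|x [//|k] A].
- split => [x k|k A]; first exact/pullback_alternating/formB.1.
  have [k2|/eqP k2] := eqVneq k 2%N; last first.
    have -> : (fun x => pullback f B x k A) = (fun=> 0).
      by apply/funext => x; rewrite P2.
    exact: csmooth_on_cst.
  subst k; rewrite (mx2_row A); set u := row _ _; set v := row _ _.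
  have -> : (fun x => pullback f B x 2%N (mx2 u v)) =
      (fun x => B (f x) 2%N (mx2 ('D_u f x) ('D_v f x))).
    by apply/funext => x; rewrite pullback_mx2.
  exact: (csmooth_on_form2 formB openT sf (sDf u) (sDf v)).
- exact: realB.
have [k2|/eqP k2] := eqVneq k 2%N; last first.
  by apply: extd_zero => y A'; exact: P2.
subst k; have := closB (f x) 3%N (A *m 'J f x).
rewrite !extd_deg3 !(row_jacobian A _ (df x)).
move: (row i0 A) (row i1 A) (row i2 A) => u v w.
have DP a b c : cderive (fun y => pullback f B y 2%N (mx2 a b)) x c =
   cderive (fun z => B z 2%N (mx2 ('D_a f x) ('D_b f x))) (f x) ('D_c f x) +
   B (f x) 2%N (mx2 ('D_c (fun y => 'D_a f y) x) ('D_b f x)) +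
   B (f x) 2%N (mx2 ('D_a f x) ('D_c (fun y => 'D_b f y) x)).
  have -> : (fun y => pullback f B y 2%N (mx2 a b)) =
      (fun y => B (f y) 2%N (mx2 ('D_a f y) ('D_b f y))).
    by apply/funext => y; rewrite pullback_mx2.
  exact: cderive_form2.
rewrite !DP => closed.
exact: (alternating_cancel ('D_u f x) ('D_v f x) ('D_w f x)
  (formB.1 (f x) 2%N) (symf v u x) (symf w u x) (symf w v x) closed).
Qed.

End PullbackClosed.

(** * Automorphisms fixing the origin act by a smooth matrix *)

Section NormalForm.
Variable R : realType.
Local Notation C := R[i].
Local Notation E2 := (C2 R).

Definition cray_mean (K : E2 -> C) (x : E2) : C :=
  ray_mean 0 (fun y => complex.Re (K y) : R) x +i*
  ray_mean 0 (fun y => complex.Im (K y) : R) x.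

Lemma csmooth_cray_mean K : csmooth K -> csmooth (cray_mean K).
Proof. by move=> [rK jK]; split; exact: smooth_ray_mean. Qed.

Lemma mean_ray_mul (p q : R) (F G : E2 -> R) x :
  continuous F -> continuous G ->
  mean (fun t => p * F (t *: x) + q * G (t *: x)) =
  p * ray_mean 0 F x + q * ray_mean 0 G x.
Proof.
move=> cF cG; have cFx := @ray_weight_continuous _ _ 0 F x cF.
have cGx := @ray_weight_continuous _ _ 0 G x cG.
have cqG : continuous (fun t : R => q * (t ^+ 0 * G (t *: x)) + 0).
  move=> t; apply: cvgD; last exact: cvg_cst.
  by apply: cvgM; [exact: cvg_cst|exact: cGx].
have c0 : continuous (fun _ : R => 0 : R) by move=> t; exact: cvg_cst.
have m0 : mean (fun _ : R => 0 : R) = 0.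
  apply/eqP; rewrite -normr_le0; apply: mean_le => // t _.
  by rewrite normr0.
have -> : (fun t => p * F (t *: x) + q * G (t *: x)) =
  (fun t => p * (t ^+ 0 * F (t *: x)) + (q * (t ^+ 0 * G (t *: x)) + 0)).
  by apply/funext => t; rewrite expr0 !mul1r addr0.
by rewrite (mean_lin _ cFx cqG) (mean_lin _ cGx c0) m0 addr0.
Qed.

(** If the derivative of f along the ray through x is divisible by c, so is the
    increment of f along it, and the quotient is an average of K, hence depends
    smoothly on x. With c := wc x this is the division by w. *)
Lemma cray_FTC (f K : E2 -> C) (c : C) x : csmooth f -> csmooth K ->
  (forall t : R, cderive f (t *: x) x = c * K (t *: x)) ->
  f x - f 0 = c * cray_mean K x.
Proof.
move=> [rf jf] [rK jK] H.
have cr : continuous (fun y => complex.Re (K y) : R).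
  by move=> y; exact: (rK 0%N).
have cj : continuous (fun y => complex.Im (K y) : R).
  by move=> y; exact: (jK 0%N).
have Er := ray_FTC x rf; have Ej := ray_FTC x jf.
apply/eqP; rewrite eq_complex; apply/andP; split; apply/eqP.
  transitivity (complex.Re (f x) - complex.Re (f 0)); first by rewrite raddfB.
  rewrite Er; transitivity (mean (fun t : R =>
     complex.Re c * complex.Re (K (t *: x)) +
     (- complex.Im c) * complex.Im (K (t *: x)))).
    congr mean; apply/funext => t.
    have /(congr1 (@complex.Re R)) := H t; rewrite /cderive /= => ->.
    by rewrite mulNr; case: c {H} => a b; case: (K _).
  by rewrite (mean_ray_mul _ _ x cr cj); case: c {H} => a b; rewrite mulNr.
transitivity (complex.Im (f x) - complex.Im (f 0)); first by rewrite raddfB.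
rewrite Ej; transitivity (mean (fun t : R =>
   complex.Re c * complex.Im (K (t *: x)) +
   complex.Im c * complex.Re (K (t *: x)))).
  congr mean; apply/funext => t.
  have /(congr1 (@complex.Im R)) := H t; rewrite /cderive /= => ->.
  by case: c {H} => a b; case: (K _).
by rewrite (mean_ray_mul _ _ x cj cr); case: c {H} => a b.
Qed.

Lemma cderive_scale (f : E2 -> C) x (t : R) v : cdiff f x ->
  cderive f x (t *: v) = t%:C * cderive f x v.
Proof.
move=> df; have := cderive_lin t 0 v 0 df.
by rewrite scale0r addr0 mul0r addr0.
Qed.

Lemma csmooth_euler (f : E2 -> C) : csmooth f -> csmooth (fun y => cderive f y y).
Proof.
move=> sf.
have E (y : E2) : \sum_j (y 0 j)%:C * cderive f y 'e_j = cderive f y y.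
  by rewrite -cderive_sum //; exact: csmooth_on_cdiff sf I.
apply: (csmooth_on_eq openT (fun y _ => E y)).
apply: (csmooth_on_sum _ openT) => j.
apply: (csmooth_on_mul openT); last exact: csmooth_on_cderive.
apply: (csmooth_on_coord j openT) => k; exact: Ck_id.
Qed.

Lemma wcZ (t : R) (x : E2) : wc (t *: x) = t%:C * wc x.
Proof.
by apply/eqP; rewrite eq_complex /= !mxE !mul0r subr0 addr0 !eqxx.
Qed.

Lemma zcZ (t : R) (x : E2) : zc (t *: x) = t%:C * zc x.
Proof.
by apply/eqP; rewrite eq_complex /= !mxE !mul0r subr0 addr0 !eqxx.
Qed.

Lemma wc_e0 : wc ('e_0 : E2) = 1.
Proof. by apply/eqP; rewrite eq_complex /= !mxE !eqxx. Qed.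
Lemma zc_e0 : zc ('e_0 : E2) = 0.
Proof. by apply/eqP; rewrite eq_complex /= !mxE !eqxx. Qed.
Lemma wc_e2 : wc ('e_2 : E2) = 0.
Proof. by apply/eqP; rewrite eq_complex /= !mxE !eqxx. Qed.
Lemma zc_e2 : zc ('e_2 : E2) = 1.
Proof. by apply/eqP; rewrite eq_complex /= !mxE !eqxx. Qed.

Lemma rho_deg0 (x : E2) Z : rho x 0%N Z = wc x.
Proof. by rewrite /rho /ext_add dw_dz_neq2 // addr0. Qed.

Lemma rho_deg2 (x u v : E2) :
  rho x 2%N (mx2 u v) = wc u * zc v - wc v * zc u.
Proof. by rewrite /rho /ext_add dw_dz_deg2 row0_mx2 row1_mx2 add0r. Qed.

Variables (phi : E2 -> E2) (B : dform R) (u : E2 -> C).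
Hypotheses (sphi : smooth phi) (phi0 : phi 0 = 0) (clB : real_closed_2form B).
Hypothesis u_neq0 : forall x, u x != 0.
Hypothesis auto : forall x, wedge (ext_exp (@B x)) (pullback phi rho x)
  = ext_scale (u x) (rho x).

Let a x := wc (phi x).
Let b x := zc (phi x).

Lemma auto_deg0 x : a x = u x * wc x.
Proof.
have := congr1 (fun r : ext R => r 0%N (0 : 'M[R]_(0, 4))) (auto x).
case: clB => formB B2 realB closB.
rewrite wedge_exp_deg0; last exact: B2.
by rewrite /pullback /ext_pull /ext_scale !rho_deg0.
Qed.

(** The degree 2 part of the automorphism equation:
    da /\ db + a B = u dw /\ dz. *)
Lemma auto_deg2 x v1 v2 :
  cderive a x v1 * cderive b x v2 - cderive a x v2 * cderive b x v1 +
  @B x 2%N (mx2 v1 v2) * a x = u x * (wc v1 * zc v2 - wc v2 * zc v1).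
Proof.
have := congr1 (fun r : ext R => r 2%N (mx2 v1 v2)) (auto x).
case: clB => formB B2 realB closB.
rewrite (wedge_exp_deg2 _ _ 0); last exact: B2.
have dphi := smooth_differentiable x sphi.
rewrite (pullback_mx2 _ _ _ dphi) rho_deg2.
rewrite {1}/pullback {1}/ext_pull rho_deg0 /ext_scale rho_deg2.
by rewrite (cderive_wc _ dphi) (cderive_zc _ dphi) (cderive_wc _ dphi)
  (cderive_zc _ dphi).
Qed.

Lemma csmooth_a : csmooth a.
Proof. exact: (csmooth_on_comp openT (csmooth_wc R) sphi). Qed.

Lemma csmooth_b : csmooth b.
Proof. exact: (csmooth_on_comp openT (csmooth_zc R) sphi). Qed.

Let cB (v : E2) : csmooth (fun x => @B x 2%N (mx2 'e_0 v)).
Proof. by case: clB => -[_]. Qed.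

(** Evaluated on the vectors 'e_0 and 'e_2, on which dw /\ dz is 1, the degree 2
    part expresses u through B and the derivatives of phi. *)
Lemma csmooth_u : csmooth u.
Proof.
have sa := csmooth_on_cderive _ csmooth_a.
have sb := csmooth_on_cderive _ csmooth_b.
have E x : cderive a x 'e_0 * cderive b x 'e_2 +
    - (cderive a x 'e_2 * cderive b x 'e_0) +
  @B x 2%N (mx2 'e_0 'e_2) * a x = u x.
  by rewrite auto_deg2 wc_e0 zc_e0 wc_e2 zc_e2 mul0r subr0 !mulr1.
apply: (csmooth_on_eq openT (fun y _ => E y)).
apply: (csmooth_on_add openT).
  apply: (csmooth_on_add openT).
    by apply: (csmooth_on_mul openT); [exact: sa|exact: sb].
  apply: (csmooth_on_opp openT).
  by apply: (csmooth_on_mul openT); [exact: sa|exact: sb].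
by apply: (csmooth_on_mul openT); [exact: cB|exact: csmooth_a].
Qed.

(** The radial derivative of b - z at y is wc y * K y; this is [cderive_auto]
    with v := y. *)
Let K (y : E2) : C := cderive b y 'e_0 +
  ((u y)^-1 * (cderive u y y * cderive b y 'e_0 +
               - (cderive u y 'e_0 * cderive b y y))
   + - (@B y 2%N (mx2 'e_0 y))).

Lemma csmooth_K : csmooth K.
Proof.
have sid : smooth (@id E2) by move=> k; exact: Ck_id.
have sc : smooth (fun _ : E2 => 'e_0 : E2) by move=> k; exact: Ck_cst.
have sdb v := csmooth_on_cderive v csmooth_b.
have sdu v := csmooth_on_cderive v csmooth_u.
have seb := csmooth_euler csmooth_b.
have seu := csmooth_euler csmooth_u.
have formB : is_form B by case: clB.
have sB := csmooth_on_form2 formB openT sid sc sid.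
apply: (csmooth_on_add openT (sdb 'e_0)).
apply: (csmooth_on_add openT); last exact: (csmooth_on_opp openT).
apply: (csmooth_on_mul openT).
  by apply: (csmooth_on_inv openT) => //; exact: csmooth_u.
apply: (csmooth_on_add openT); first exact: (csmooth_on_mul openT).
by apply: (csmooth_on_opp openT); exact: (csmooth_on_mul openT).
Qed.

(** The heart of the proof. Since a = u w, the degree 2 part reads
    u dw /\ d(b - z) = w times a smooth 2-form, so d(b - z) is a combination of
    dw and of w times a smooth 1-form. Contracting with 'e_0, on which dw is 1
    and dz is 0, makes both coefficients explicit. *)
Lemma cderive_auto x v : cderive (fun y => b y + - zc y) x v =
  wc v * cderive b x 'e_0 + wc x * ((u x)^-1 *
    (cderive u x v * cderive b x 'e_0 - cderive u x 'e_0 * cderive b x v)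
    - @B x 2%N (mx2 'e_0 v)).
Proof.
have du : cdiff u x := csmooth_on_cdiff csmooth_u I.
have db : cdiff b x := csmooth_on_cdiff csmooth_b I.
have da w : cderive a x w = cderive u x w * wc x + u x * wc w.
  have -> : a = (fun y => u y * wc y) by apply/funext => y; exact: auto_deg0.
  by rewrite (cderive_mul w du (cdiff_wc x)) cderive_wc_id.
have dnz : cdiff (fun y => - zc y) x.
  exact: csmooth_on_cdiff (csmooth_on_opp openT (csmooth_zc R)) I.
rewrite (cderive_add v db dnz) (cderive_opp v (cdiff_zc x)) cderive_zc_id.
have := auto_deg2 x 'e_0 v; rewrite !da auto_deg0 wc_e0 zc_e0 mulr0 subr0 mul1r.
move: (cderive b x v) (cderive b x 'e_0) (cderive u x v) (cderive u x 'e_0).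
move: (@B x 2%N _) (wc v) (zc v) (wc x) (u_neq0 x).
move: (u x) => U beta wv zv w U0 bv b0 uv u0 E.
apply: (mulfI U0); rewrite mulrBr -E.
by field.
Qed.

(** By [cderive_auto] the radial derivative of b - z at y is wc y times the
    smooth function K y, and b - z vanishes at the origin, so that [cray_FTC]
    applies. *)
Lemma automorphism_normal_form : exists H : E2 -> C,
  [/\ csmooth u, csmooth H, forall x, wc (phi x) = u x * wc x
    & forall x, zc (phi x) = zc x + H x * wc x].
Proof.
exists (cray_mean K); split => [||x|x].
- exact: csmooth_u.
- exact/csmooth_cray_mean/csmooth_K.
- exact: auto_deg0.
have sf : csmooth (fun y => b y + - zc y).
  exact: (csmooth_on_add openT csmooth_b (csmooth_on_opp openT (csmooth_zc R))).
have H (t : R) : cderive (fun y => b y + - zc y) (t *: x) x = wc x * K (t *: x).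
  have du : cdiff u (t *: x) := csmooth_on_cdiff csmooth_u I.
  have db : cdiff b (t *: x) := csmooth_on_cdiff csmooth_b I.
  have formB : is_form B by case: clB.
  rewrite cderive_auto /K (cderive_scale t x du) (cderive_scale t x db) wcZ.
  rewrite (alt2_scaler t 'e_0 x (formB.1 (t *: x) 2%N)).
  move: (cderive b _ _) (cderive b _ _) (cderive u _ _) (cderive u _ _).
  move: (@B _ _ _) (u _)^-1 => *; ring.
have := cray_FTC sf csmooth_K H; rewrite /b phi0.
have -> : zc (0 : E2) = 0 by rewrite -(scale0r 0) zcZ mul0r.
by rewrite !subr0 => /eqP; rewrite subr_eq addrC mulrC => /eqP.
Qed.

End NormalForm.

(** * Charts of the blow-up *)

Section Charts.
Variable R : realType.
Local Notation C := R[i].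
Local Notation E2 := (C2 R).
Implicit Types (x y v : E2) (i j : bool).

(** The blow-down map read in a chart, classically a monoidal transformation. *)
Definition monoidal i x : E2 := blowdown (chart i x).
(** A basis of the line that belongs to the point of coordinates x. *)
Definition tautological i x : E2 :=
  if i then mkC2 1 (zc x) else mkC2 (wc x) 1.
(** In chart i this is both the local equation of the exceptional divisor and
    the linear form that is 1 on the tautological vector. *)
Definition coeff i v : C := if i then wc v else zc v.

Lemma C2_eq x y : wc x = wc y -> zc x = zc y -> x = y.
Proof. by move=> ew ez; rewrite -[x]mkC2K -[y]mkC2K ew ez. Qed.

Lemma C2_eq0 x : wc x = 0 -> zc x = 0 -> x = 0.
Proof. by move=> ew ez; apply: C2_eq; rewrite -(scale0r (0 : E2)) (wcZ, zcZ) mul0r. Qed.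

Lemma wc_scale c v : wc (scaleC2 c v) = c * wc v.
Proof. by rewrite /scaleC2 wcK. Qed.

Lemma zc_scale c v : zc (scaleC2 c v) = c * zc v.
Proof. by rewrite /scaleC2 zcK. Qed.

Lemma coeff_scale i c v : coeff i (scaleC2 c v) = c * coeff i v.
Proof. by case: i; rewrite /coeff (wc_scale, zc_scale). Qed.

Lemma scaleC2A c d v : scaleC2 c (scaleC2 d v) = scaleC2 (c * d) v.
Proof. by rewrite /scaleC2 wcK zcK !mulrA. Qed.

Lemma bl_line_chart i x : bl_line (chart i x) = cline (tautological i x).
Proof. by case: i. Qed.

Lemma wc_monoidal i x : wc (monoidal i x) = if i then wc x else wc x * zc x.
Proof. by case: i; rewrite /monoidal /= wcK. Qed.

Lemma zc_monoidal i x : zc (monoidal i x) = if i then wc x * zc x else zc x.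
Proof. by case: i; rewrite /monoidal /= zcK. Qed.

Lemma monoidalE i x : monoidal i x = scaleC2 (coeff i x) (tautological i x).
Proof.
apply: C2_eq; rewrite ?wc_scale ?zc_scale ?wc_monoidal ?zc_monoidal.
  by case: i; rewrite /= wcK ?mulr1 // mulrC.
by case: i; rewrite /= zcK ?mulr1.
Qed.

Lemma coeff_tautological i x : coeff i (tautological i x) = 1.
Proof. by case: i; rewrite /= (wcK, zcK). Qed.

Lemma tautological_neq0 i x : tautological i x != 0.
Proof.
apply/eqP => /(congr1 (coeff i)); rewrite coeff_tautological.
have -> : coeff i (0 : E2) = 0.
  by case: i; rewrite /= -(scale0r (0 : E2)) (wcZ, zcZ) mul0r.
by move/eqP; rewrite oner_eq0.
Qed.

Lemma coeff_neq0 v : v != 0 -> exists i, coeff i v != 0.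
Proof.
move=> v0; have [w0|w0] := eqVneq (wc v) 0; last by exists true.
exists false; apply: contra_neq v0 => z0; exact: C2_eq0.
Qed.

Lemma cline_scale c v : c != 0 -> cline (scaleC2 c v) = cline v.
Proof.
move=> c0; apply/seteqP; split => y [d _ <-].
  by exists (d * c) => //; rewrite scaleC2A.
by exists (d / c) => //; rewrite scaleC2A divfK.
Qed.

Lemma cline_coeff i y v : cline (tautological i y) v ->
  v = scaleC2 (coeff i v) (tautological i y).
Proof.
by move=> [c _ <-]; rewrite coeff_scale coeff_tautological mulr1.
Qed.

(** The coordinates in chart j of the point x equipped with the line spanned by
    v; they make sense when coeff j v is nonzero. *)
Definition chart_coord j (x v : E2) : E2 :=
  if j then mkC2 (wc x) (zc v / wc v) else mkC2 (wc v / zc v) (zc x).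

Lemma chart_coordK j (q : blowup R) v : bl_line q = cline v ->
  coeff j v != 0 -> chart j (chart_coord j (blowdown q) v) = q.
Proof.
move=> eL v0; have := bl_mem q; rewrite eL => -[c _ ec].
have eT : scaleC2 (coeff j v)
    (tautological j (chart_coord j (blowdown q) v)) = v.
  case: j v0 => v0; apply: C2_eq; rewrite ?wc_scale ?zc_scale /= ?wcK ?zcK.
  - by rewrite mulr1.
  - by rewrite mulrC divfK.
  - by rewrite mulrC divfK.
  - by rewrite mulr1.
apply: blowup_eq; last first.
  by rewrite bl_line_chart eL -[in RHS]eT cline_scale.
have ct : coeff j (chart_coord j (blowdown q) v) = c * coeff j v.
  by rewrite -coeff_scale ec; case: j {v0 eT}; rewrite /= (wcK, zcK).
by rewrite -/(monoidal _ _) monoidalE ct -scaleC2A eT.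
Qed.

Lemma csmooth_coeff i : csmooth (coeff i).
Proof. by case: i; [exact: csmooth_wc|exact: csmooth_zc]. Qed.

Lemma csmooth_cst (a : C) : csmooth (fun _ : E2 => a).
Proof. exact: csmooth_on_cst. Qed.

Lemma smooth_monoidal i : smooth (monoidal i).
Proof.
have sw := csmooth_wc R; have sz := csmooth_zc R.
have swz := csmooth_on_mul openT sw sz.
by case: i; exact: (smooth_on_mkC2 openT).
Qed.

Lemma smooth_tautological i : smooth (tautological i).
Proof.
have sw := csmooth_wc R; have sz := csmooth_zc R; have s1 := csmooth_cst 1.
by case: i; exact: (smooth_on_mkC2 openT).
Qed.

Lemma diff_monoidal i x : differentiable (monoidal i) x.
Proof. exact/smooth_differentiable/smooth_monoidal. Qed.

Lemma cderive_wz x v :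
  cderive (fun y => wc y * zc y) x v = wc v * zc x + wc x * zc v.
Proof.
by rewrite (cderive_mul v (cdiff_wc x) (cdiff_zc x)) cderive_wc_id cderive_zc_id.
Qed.

Lemma wc_derive_monoidal i x v : wc ('D_v (monoidal i) x) =
  if i then wc v else wc v * zc x + wc x * zc v.
Proof.
rewrite -(cderive_wc v (diff_monoidal i x)).
under eq_fun do rewrite wc_monoidal.
by case: i; [exact: cderive_wc_id|exact: cderive_wz].
Qed.

Lemma zc_derive_monoidal i x v : zc ('D_v (monoidal i) x) =
  if i then wc v * zc x + wc x * zc v else zc v.
Proof.
rewrite -(cderive_zc v (diff_monoidal i x)).
under eq_fun do rewrite zc_monoidal.
by case: i; [exact: cderive_wz|exact: cderive_zc_id].
Qed.

Lemma cderive_wz2 x u v :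
  cderive (fun y => wc v * zc y + wc y * zc v) x u = wc v * zc u + wc u * zc v.
Proof.
have c (a : C) : cdiff (fun _ : E2 => a) x.
  exact: csmooth_on_cdiff (csmooth_cst a) I.
rewrite (cderive_add u (cdiff_mul (c _) (cdiff_zc x))
  (cdiff_mul (cdiff_wc x) (c _))).
rewrite (cderive_mul u (c _) (cdiff_zc x)) (cderive_mul u (cdiff_wc x) (c _)).
by rewrite !cderive_cst cderive_wc_id cderive_zc_id mul0r mulr0 add0r addr0.
Qed.

Lemma derive2_monoidal i u v x :
  'D_u (fun y => 'D_v (monoidal i) y) x = 'D_v (fun y => 'D_u (monoidal i) y) x.
Proof.
have dd w : differentiable (fun y => 'D_w (monoidal i) y) x.
  by apply: smooth_differentiable => k; exact: (smooth_monoidal i k.+1).2.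
have Ew a b : wc ('D_a (fun y => 'D_b (monoidal i) y) x) =
    cderive (fun y => if i then wc b else wc b * zc y + wc y * zc b) x a.
  apply: etrans (esym (cderive_wc a (dd b))) _; congr (cderive _ x a).
  by apply/funext => y; exact: wc_derive_monoidal.
have Ez a b : zc ('D_a (fun y => 'D_b (monoidal i) y) x) =
    cderive (fun y => if i then wc b * zc y + wc y * zc b else zc b) x a.
  apply: etrans (esym (cderive_zc a (dd b))) _; congr (cderive _ x a).
  by apply/funext => y; exact: zc_derive_monoidal.
apply: C2_eq.
  apply: etrans (Ew u v) _; apply: etrans _ (esym (Ew v u)).
  by case: i {dd Ew Ez}; rewrite ?cderive_cst // !cderive_wz2; ring.
apply: etrans (Ez u v) _; apply: etrans _ (esym (Ez v u)).
by case: i {dd Ew Ez}; rewrite ?cderive_cst // !cderive_wz2; ring.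
Qed.

Lemma bl_rho_deg0 i x Z : @bl_rho R i x 0%N Z = if i then 1 else wc x.
Proof. by case: i; rewrite /= ?rho_deg0 // /ext_add dw_dz_neq2 // addr0. Qed.

Lemma bl_rho_deg2 i x u v :
  @bl_rho R i x 2%N (mx2 u v) = wc u * zc v - wc v * zc u.
Proof.
case: i; rewrite /= ?rho_deg2 //.
by rewrite /ext_add dw_dz_deg2 row0_mx2 row1_mx2 add0r.
Qed.

Lemma rho_other x k (A : 'M[R]_(k, 4)) : k <> 0%N -> k <> 2%N -> @rho R x k A = 0.
Proof.
by move=> k0 k2; rewrite /rho /ext_add dw_dz_neq2 // addr0; case: k A k0 k2.
Qed.

Lemma bl_rho_other i x k (A : 'M[R]_(k, 4)) :
  k <> 0%N -> k <> 2%N -> @bl_rho R i x k A = 0.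
Proof.
move=> k0 k2; case: i; rewrite /= ?rho_other //.
by rewrite /ext_add dw_dz_neq2 // addr0; case: k A k0 k2.
Qed.

(** Both w and dw /\ dz acquire the equation of the exceptional divisor as a
    factor. This is what makes the structure lift to the blow-up. *)
Lemma pullback_monoidal_rho i x :
  pullback (monoidal i) rho x = ext_scale (coeff i x) (bl_rho i x).
Proof.
apply: extP => k A; rewrite /ext_scale.
have [k0|/eqP k0] := eqVneq k 0%N.
  subst k; rewrite /pullback /ext_pull rho_deg0 bl_rho_deg0 wc_monoidal.
  by case: i => /=; rewrite ?mulr1 // mulrC.
have [k2|/eqP k2] := eqVneq k 2%N; last first.
  by rewrite /pullback /ext_pull rho_other // bl_rho_other // mulr0.
subst k; rewrite (mx2_row A) (pullback_mx2 _ _ _ (diff_monoidal i x)).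
rewrite rho_deg2 bl_rho_deg2 !wc_derive_monoidal !zc_derive_monoidal.
by case: i => /=; ring.
Qed.

End Charts.

(** * The lift to the blow-up *)

Section Lift.
Variable R : realType.
Local Notation C := R[i].
Local Notation E2 := (C2 R).
Implicit Types (x y v : E2) (i j : bool).

(** The action of the matrix with rows (u, 0) and (h, 1). *)
Definition twist (u h : C) (v : E2) : E2 := mkC2 (u * wc v) (zc v + h * wc v).

Lemma twist_scale u h c v : twist u h (scaleC2 c v) = scaleC2 c (twist u h v).
Proof.
rewrite /twist; apply: C2_eq; rewrite ?(wcK, zcK, wc_scale, zc_scale); ring.
Qed.

Lemma twistK u h v : u != 0 -> twist u^-1 (- h * u^-1) (twist u h v) = v.
Proof. by move=> u0; rewrite /twist; apply: C2_eq; rewrite ?(wcK, zcK); field. Qed.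

Lemma twistVK u h v : u != 0 -> twist u h (twist u^-1 (- h * u^-1) v) = v.
Proof. by move=> u0; rewrite /twist; apply: C2_eq; rewrite ?(wcK, zcK); field. Qed.

Lemma twist0 u h : twist u h 0 = 0.
Proof.
have w0 : wc (0 : E2) = 0 by rewrite -(scale0r (0 : E2)) wcZ mul0r.
have z0 : zc (0 : E2) = 0 by rewrite -(scale0r (0 : E2)) zcZ mul0r.
by apply: C2_eq; rewrite /twist ?wcK ?zcK ?z0 w0 mulr0 ?addr0.
Qed.

Lemma twist_neq0 u h v : u != 0 -> v != 0 -> twist u h v != 0.
Proof.
by move=> u0; apply: contra_neq => e; rewrite -(twistK h v u0) e twist0.
Qed.

Lemma twist_cline u h v : twist u h @` cline v = cline (twist u h v).
Proof.
apply/seteqP; split => [_ [_ [c _ <-] <-]|_ [c _ <-]].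
  by exists c => //; rewrite twist_scale.
by exists (scaleC2 c v); [exists c|rewrite twist_scale].
Qed.

(** Such a factorisation phi x = M(x) x determines an action on lines through
    the origin that varies smoothly even at x = 0. *)
Record twisted (phi : E2 -> E2) (u h : E2 -> C) : Prop := Twisted {
  twisted_u : csmooth u;
  twisted_h : csmooth h;
  twisted_neq0 : forall x, u x != 0;
  twistedE : forall x, phi x = twist (u x) (h x) x }.

(** From phi x = M(x) x one gets psi y = M(psi y)^-1 y, and the inverse of a
    matrix of this shape has the same shape. *)
Lemma twisted_inverse phi psi u h : cancel phi psi -> cancel psi phi ->
  smooth psi -> twisted phi u h ->
  twisted psi (fun y => (u (psi y))^-1)
              (fun y => - h (psi y) * (u (psi y))^-1).
Proof.
move=> phiK psiK spsi [su sh u0 E].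
have sup := csmooth_on_comp openT su spsi.
have shp := csmooth_on_comp openT sh spsi.
have siu : csmooth (fun y => (u (psi y))^-1).
  by apply: (csmooth_on_inv openT _ sup) => y _; exact: u0.
split => [//||y|y]; last 2 first.
- by rewrite invr_eq0.
- by have := twistK (h (psi y)) (psi y) (u0 (psi y)); rewrite -E psiK => ->.
apply: (csmooth_on_mul openT _ siu).
exact: (csmooth_on_opp openT shp).
Qed.

Section OneLift.
Variables (phi : E2 -> E2) (u h : E2 -> C).
Hypothesis tphi : twisted phi u h.

Local Notation M x := (twist (u x) (h x)).

Lemma lift_lineP (q : blowup R) : exists2 v, v != 0 &
  M (blowdown q) @` bl_line q = cline v.
Proof.
have [v v0 eL] := bl_lineP q; exists (M (blowdown q) v).
  exact: twist_neq0 (twisted_neq0 tphi _) v0.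
by rewrite eL twist_cline.
Qed.

Lemma lift_mem (q : blowup R) :
  (M (blowdown q) @` bl_line q) (phi (blowdown q)).
Proof. by exists (blowdown q); [exact: bl_mem|rewrite (twistedE tphi)]. Qed.

Definition blowup_lift (q : blowup R) : blowup R := Blowup (lift_lineP q) (lift_mem q).

(** A nonzero vector of the image of the line at the point of coordinates y; it
    depends smoothly on y, also along the exceptional divisor. *)
Definition moving i y : E2 := M (monoidal i y) (tautological i y).

Lemma bl_line_lift i y : bl_line (blowup_lift (chart i y)) = cline (moving i y).
Proof. by rewrite /= bl_line_chart twist_cline. Qed.

Lemma phi_monoidal i y :
  phi (monoidal i y) = scaleC2 (coeff i y) (moving i y).
Proof.
by rewrite (twistedE tphi) {3}monoidalE twist_scale.
Qed.

Lemma moving_neq0 i y : moving i y != 0.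
Proof.
exact: twist_neq0 (twisted_neq0 tphi _) (tautological_neq0 i y).
Qed.

Lemma csmooth_u_monoidal i : csmooth (fun y => u (monoidal i y)).
Proof.
exact: (csmooth_on_comp openT (twisted_u tphi) (smooth_monoidal R i)).
Qed.

Lemma smooth_phi : smooth phi.
Proof.
have -> : phi = fun x => mkC2 (u x * wc x) (zc x + h x * wc x).
  by apply/funext => x; rewrite (twistedE tphi).
have sw := csmooth_wc R; have sz := csmooth_zc R.
have [su sh _ _] := tphi.
have s1 := csmooth_on_mul openT su sw.
have s2 := csmooth_on_add openT sz (csmooth_on_mul openT sh sw).
exact: (smooth_on_mkC2 openT s1 s2).
Qed.

Lemma smooth_moving i : smooth (moving i).
Proof.
have [su sh _ _] := tphi; have sp := smooth_monoidal R i.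
have st := smooth_tautological R i.
have sw := csmooth_on_comp openT (csmooth_wc R) st.
have sz := csmooth_on_comp openT (csmooth_zc R) st.
have sup := csmooth_on_comp openT su sp.
have shp := csmooth_on_comp openT sh sp.
have s1 := csmooth_on_mul openT sup sw.
have s2 := csmooth_on_add openT sz (csmooth_on_mul openT shp sw).
exact: (smooth_on_mkC2 openT s1 s2).
Qed.

Lemma csmooth_mult i j : csmooth (fun y => coeff j (moving i y)).
Proof.
exact: (csmooth_on_comp openT (csmooth_coeff R j) (smooth_moving i)).
Qed.

Lemma open_csmooth_neq0 (f : E2 -> C) : csmooth f -> open [set y | f y != 0].
Proof.
move=> [rf jf].
pose N y := complex.Re (f y) * complex.Re (f y) +
  complex.Im (f y) * complex.Im (f y) : R.
have -> : [set y | f y != 0] = N @^-1` [set t | t != 0].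
  apply/seteqP; split => y /=; rewrite /N eq_complex /= -!expr2.
    by rewrite paddr_eq0 ?sqr_ge0 // !sqrf_eq0.
  by rewrite paddr_eq0 ?sqr_ge0 // !sqrf_eq0.
apply: open_comp; last exact: open_neq.
move=> y _; exact: (Ck_add openT (Ck_mul openT (rf 0%N) (rf 0%N))
  (Ck_mul openT (jf 0%N) (jf 0%N)) y I).
Qed.

(** The coordinates of the image in chart j are quotients with denominator
    coeff j (moving i y), and some j makes it nonzero at x. *)
Lemma lift_local_expr i x : exists j g, local_expr blowup_lift i j x g.
Proof.
have [j mx] := coeff_neq0 (moving_neq0 i x).
exists j, (fun y => chart_coord j (phi (monoidal i y)) (moving i y)).
set U := [set y | coeff j (moving i y) != 0].
have oU : open U := open_csmooth_neq0 (csmooth_mult i j).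
split; last first.
  apply: filterS (open_nbhs_nbhs (conj oU mx)) => y Uy.
  by rewrite -[phi _]/(blowdown (blowup_lift (chart i y))) chart_coordK // bl_line_lift.
exists U; split => //.
have sp : smooth (phi \o monoidal i).
  move=> k; apply: Ck_rV => [|l]; first exact: openT.
  have := Ck_coord l openT (smooth_phi k) => Cl.
  exact: (@Ck_comp _ _ k _ setT setT (fun z : E2 => phi z 0 l : R) (monoidal i)
    openT (fun _ _ => I) Cl (smooth_monoidal R i k)).
have sw := csmooth_on_sub U (csmooth_on_comp openT (csmooth_wc R) sp).
have sz := csmooth_on_sub U (csmooth_on_comp openT (csmooth_zc R) sp).
have sm l := csmooth_on_sub U (csmooth_mult i l).
case: j mx @U oU sw sz sm => mx U oU sw sz sm.
  have si := csmooth_on_inv oU (fun y Uy => Uy) (sm true).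
  exact: (smooth_on_mkC2 oU sw (csmooth_on_mul oU (sm false) si)).
have si := csmooth_on_inv oU (fun y Uy => Uy) (sm false).
exact: (smooth_on_mkC2 oU (csmooth_on_mul oU (sm true) si) sz).
Qed.

End OneLift.

Lemma lift_cancel phi psi u h u' h' (tphi : twisted phi u h)
    (tpsi : twisted psi u' h') : cancel phi psi ->
  (forall x v, twist (u' (phi x)) (h' (phi x)) (twist (u x) (h x) v) = v) ->
  cancel (blowup_lift tphi) (blowup_lift tpsi).
Proof.
move=> phiK tK q; apply: blowup_eq => /=; first exact: phiK.
apply/seteqP; split => [_ [_ [v Lv <-] <-]|v Lv]; first by rewrite tK.
by exists (twist (u (blowdown q)) (h (blowdown q)) v); [exists v|exact: tK].
Qed.

Lemma lift_diffeomorphism phi u h (tphi : twisted phi u h) :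
  diffeomorphism phi -> bl_diffeomorphism (blowup_lift tphi).
Proof.
move=> [psi [phiK psiK _ spsi]].
have tpsi := twisted_inverse phiK psiK spsi tphi.
have u0 := twisted_neq0 tphi.
exists (blowup_lift tpsi); split.
- by apply: lift_cancel => // x v; rewrite phiK twistK.
- by apply: lift_cancel => // x v; rewrite twistVK.
- exact: lift_local_expr.
- exact: lift_local_expr.
Qed.

End Lift.

(** * Continuation across the exceptional divisor *)

Section Continuity.
Variable R : realType.
Local Notation C := R[i].
Local Notation E2 := (C2 R).
Implicit Types (f g : E2 -> C) (x : E2).

Definition ccont f x : Prop :=
  {for x, continuous (fun y => complex.Re (f y) : R)} /\
  {for x, continuous (fun y => complex.Im (f y) : R)}.

Lemma csmooth_on_ccont U f x : csmooth_on U f -> U x -> ccont f x.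
Proof. by move=> [rf jf] Ux; split; [exact: (rf 0%N)|exact: (jf 0%N)]. Qed.

Lemma csmooth_ccont f x : csmooth f -> ccont f x.
Proof. by move=> sf; exact: (csmooth_on_ccont sf I). Qed.

Lemma ccont_cst (a : C) x : ccont (fun=> a) x.
Proof. exact/csmooth_ccont/csmooth_cst. Qed.

Lemma ccont_add f g x : ccont f x -> ccont g x -> ccont (fun y => f y + g y) x.
Proof.
move=> [rf jf] [rg jg]; split.
  have -> : (fun y => complex.Re (f y + g y) : R) =
    (fun y => complex.Re (f y)) \+ (fun y => complex.Re (g y)).
    by apply/funext => y; rewrite raddfD.
  exact: continuousD.
have -> : (fun y => complex.Im (f y + g y) : R) =
  (fun y => complex.Im (f y)) \+ (fun y => complex.Im (g y)).
  by apply/funext => y; rewrite raddfD.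
exact: continuousD.
Qed.

Lemma ccont_mul f g x : ccont f x -> ccont g x -> ccont (fun y => f y * g y) x.
Proof.
move=> [rf jf] [rg jg]; split.
  have -> : (fun y => complex.Re (f y * g y) : R) =
    (fun y => complex.Re (f y)) \* (fun y => complex.Re (g y)) \-
    (fun y => complex.Im (f y)) \* (fun y => complex.Im (g y)).
    by apply/funext => y /=; case: (f y) => ? ?; case: (g y).
  by apply: continuousB; exact: continuousM.
have -> : (fun y => complex.Im (f y * g y) : R) =
  (fun y => complex.Re (f y)) \* (fun y => complex.Im (g y)) \+
  (fun y => complex.Im (f y)) \* (fun y => complex.Re (g y)).
  by apply/funext => y /=; case: (f y) => ? ?; case: (g y).
by apply: continuousD; exact: continuousM.
Qed.

Lemma ccont_sum (I : Type) (r : seq I) (f : I -> E2 -> C) x :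
  (forall i, ccont (f i) x) -> ccont (fun y => \sum_(i <- r) f i y) x.
Proof.
move=> cf; elim: r => [|i r IH].
  by under eq_fun do rewrite big_nil; exact: ccont_cst.
by under eq_fun do rewrite big_cons; exact: ccont_add.
Qed.

Lemma ccont_near f g x : (\forall y \near x, f y = g y) ->
  ccont f x -> ccont g x.
Proof.
move=> fg [rf jf].
have fr : \forall y \near x, complex.Re (f y) = complex.Re (g y) :> R.
  by apply: filterS fg => y ->.
have fj : \forall y \near x, complex.Im (f y) = complex.Im (g y) :> R.
  by apply: filterS fg => y ->.
split.
  change ((complex.Re (g y) : R) @[y --> x] --> (complex.Re (g x) : R)).
  rewrite -(nbhs_singleton fg); apply: cvg_trans rf; exact: (near_eq_cvg fr).
change ((complex.Im (g y) : R) @[y --> x] --> (complex.Im (g x) : R)).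
rewrite -(nbhs_singleton fg); apply: cvg_trans jf; exact: (near_eq_cvg fj).
Qed.

Definition ext_cont (omega : dform R) x : Prop :=
  forall k A, ccont (fun y => omega y k A) x.

Lemma ext_cont_wedge (a b : dform R) x : ext_cont a x -> ext_cont b x ->
  ext_cont (fun y => wedge (a y) (b y)) x.
Proof.
move=> ca cb k A; apply: ccont_sum => S.
by apply: ccont_mul; [apply: ccont_mul => //; exact: ccont_cst|exact: cb].
Qed.

Lemma ext_cont_exp (a : dform R) x : ext_cont a x ->
  ext_cont (fun y => ext_exp (a y)) x.
Proof.
move=> ca k A; apply: ccont_add; first exact: ccont_cst.
apply: ccont_add; first exact: ca.
by apply: ccont_mul; [exact: ccont_cst|exact: ext_cont_wedge].
Qed.

Lemma nbhs_ray x v (P : set E2) : nbhs x P ->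
  exists2 t : R, t != 0 & P (x + t *: v).
Proof.
move=> Px.
have c : (x + t *: v) @[t --> (0 : R)] --> x + 0 *: v.
  by apply: cvgD; [exact: cvg_cst|exact: scalel_continuous].
rewrite scale0r addr0 in c.
have /nbhs_ballP [e /= e0 He] := c P Px.
exists (e / 2); first by rewrite gt_eqF // divr_gt0.
apply: He; rewrite -ball_normE /= sub0r normrN gtr0_norm ?divr_gt0 //.
by rewrite ltr_pdivrMr // ltr_pMr // ltr1n.
Qed.

Lemma continuous_eq0_dense (F : E2 -> R) x (P : set E2) : {for x, continuous F} ->
  (forall Q, nbhs x Q -> exists2 y, Q y & P y) ->
  (\forall y \near x, P y -> F y = 0) -> F x = 0.
Proof.
move=> cF dP H; apply/eqP; apply: contraT => F0.
have Fp : 0 < `|F x| by rewrite normr_gt0.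
have nF : \forall y \near x, `|F x - F y| < `|F x|.
  by have /cvgrPdist_lt := cF; exact.
have [y [Hy ny] Py] := dP _ (filterI H nF).
by move: ny; rewrite Hy // subr0 ltxx.
Qed.

Lemma coeff_dense i x (Q : set E2) : nbhs x Q ->
  exists2 y, Q y & coeff i y != 0.
Proof.
move=> nQ; have [ci|ci] := eqVneq (coeff i x) 0; last first.
  by exists x => //; exact: nbhs_singleton.
(* along e the function coeff i grows like t *)
pose e : E2 := if i then 'e_0 else 'e_2.
have [t t0 Qt] := nbhs_ray e nQ; exists (x + t *: e) => //.
have -> : coeff i (x + t *: e) = t%:C.
  have wD (a b : E2) : wc (a + b) = wc a + wc b.
    by apply/eqP; rewrite eq_complex /= !mxE !eqxx.
  have zD (a b : E2) : zc (a + b) = zc a + zc b.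
    by apply/eqP; rewrite eq_complex /= !mxE !eqxx.
  rewrite /e; case: (i) ci => /= ci.
    by rewrite wD ci wcZ wc_e0 mulr1 add0r.
  by rewrite zD ci zcZ zc_e2 mulr1 add0r.
by rewrite eq_complex /= negb_and t0.
Qed.

(** The complement of the exceptional divisor is dense. *)
Lemma extend_over_exceptional i (F G : E2 -> C) x :
  ccont F x -> ccont G x ->
  (\forall y \near x, coeff i y != 0 -> F y = G y) -> F x = G x.
Proof.
move=> cF cG FG; apply/eqP; rewrite -subr_eq0.
have [r j] : ccont (fun y => F y + (-1) * G y) x.
  exact: (ccont_add cF (ccont_mul (ccont_cst (-1) x) cG)).
have H : \forall y \near x, coeff i y != 0 -> F y + (-1) * G y = 0.
  by apply: filterS FG => y /[apply] ->; rewrite mulN1r subrr.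
rewrite -[- G x]mulN1r eq_complex; apply/andP; split; apply/eqP.
  apply: (continuous_eq0_dense r (@coeff_dense i x)).
  by apply: filterS H => y /[apply] ->.
apply: (continuous_eq0_dense j (@coeff_dense i x)).
by apply: filterS H => y /[apply] ->.
Qed.

Lemma is_form_ext_cont (omega : dform R) x : is_form omega -> ext_cont omega x.
Proof. by move=> [_ s] k A; apply: csmooth_ccont. Qed.

Lemma ext_cont_bl_rho i x : ext_cont (@bl_rho R i) x.
Proof.
move=> k A; have [k0|/eqP k0] := eqVneq k 0%N.
  subst k; under eq_fun do rewrite bl_rho_deg0.
  by case: i; [exact: ccont_cst|exact/csmooth_ccont/csmooth_wc].
have [k2|/eqP k2] := eqVneq k 2%N; last first.
  by under eq_fun do rewrite bl_rho_other //; exact: ccont_cst.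
subst k; rewrite (mx2_row A).
by under eq_fun do rewrite bl_rho_deg2; exact: ccont_cst.
Qed.

(** The entries of the Jacobian matrix are first derivatives of g, which is
    smooth near x. *)
Lemma ext_cont_pull_bl_rho j (g : E2 -> E2) x : smooth_near x g ->
  ext_cont (fun y => ext_pull ('J g y) (bl_rho j (g y))) x.
Proof.
move=> [U [oU Ux sg]] k A.
have nU : \forall y \near x, U y by exact: open_nbhs_nbhs.
have dg y : U y -> differentiable g y by have [+ _] := sg 1; exact.
have sw := csmooth_on_comp oU (csmooth_wc R) sg.
have sz := csmooth_on_comp oU (csmooth_zc R) sg.
have [k0|/eqP k0] := eqVneq k 0%N.
  subst k; rewrite /ext_pull; under eq_fun do rewrite bl_rho_deg0.
  by case: j; [exact: ccont_cst|exact: csmooth_on_ccont sw Ux].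
have [k2|/eqP k2] := eqVneq k 2%N; last first.
  rewrite /ext_pull; under eq_fun do rewrite bl_rho_other //.
  exact: ccont_cst.
subst k; pose a v y := cderive (fun y => wc (g y)) y v.
pose b v y := cderive (fun y => zc (g y)) y v.
have ca v : ccont (a v) x := csmooth_on_ccont (csmooth_on_cderive v sw) Ux.
have cb v : ccont (b v) x := csmooth_on_ccont (csmooth_on_cderive v sz) Ux.
pose u := row ord0 A; pose v := row ord_max A.
apply: (@ccont_near (fun y => a u y * b v y + -1 * (a v y * b u y))).
  apply: filterS nU => y /dg dgy.
  rewrite /ext_pull (mx2_row (A *m _)) bl_rho_deg2.
  rewrite (row_jacobian A ord0 dgy) (row_jacobian A ord_max dgy) mulN1r.
  by rewrite /a /b !(cderive_wc _ dgy) !(cderive_zc _ dgy).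
apply: ccont_add; first exact: ccont_mul.
by apply: ccont_mul; [exact: ccont_cst|exact: ccont_mul].
Qed.

End Continuity.

(** * The lift preserves the generalized complex structure *)

Section Automorphism.
Variable R : realType.
Local Notation C := R[i].
Local Notation E2 := (C2 R).
Variables (phi : E2 -> E2) (B : dform R) (u h : E2 -> C).
Hypotheses (tphi : twisted phi u h) (clB : real_closed_2form B).
Hypothesis auto : forall x,
  wedge (ext_exp (@B x)) (pullback phi rho x) = ext_scale (u x) (rho x).

Local Notation BB i := (pullback (monoidal i) B).

Lemma monoidal_real_closed i : real_closed_2form (BB i).
Proof.
apply: pullback_real_closed clB; first exact: smooth_monoidal.
exact: derive2_monoidal.
Qed.

Lemma monoidal_compatible : bl_compatible (blowdown_pullback B).
Proof.
move=> i j x g [[U [oU Ux sg]] e].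
have dg : differentiable g x by have [+ _] := sg 1; exact.
apply: (@pullback_chain _ B (monoidal i) g (monoidal j)) => //.
- exact: diff_monoidal.
- exact: diff_monoidal.
- by apply: filterS e => y /(congr1 (@blowdown R)).
Qed.

Lemma ext_pull_scale (L : 'M[R]_4) c (a : ext R) :
  ext_pull L (ext_scale c a) = ext_scale c (ext_pull L a).
Proof. by []. Qed.

Lemma wedge_exp_pull (L : 'M[R]_4) (b a : ext R) :
  ext_pull L (wedge (ext_exp b) a) =
  wedge (ext_exp (ext_pull L b)) (ext_pull L a).
Proof. by rewrite ext_exp_pull wedge_pull. Qed.

Lemma ext_scale_inj c (a b : ext R) : c != 0 ->
  ext_scale c a = ext_scale c b -> a = b.
Proof.
move=> c0 e; apply: extP => k A.
by apply: (mulfI c0); have := congr1 (fun r : ext R => r k A) e.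
Qed.

(** The matrix of phi maps the tautological vector at y to a nonzero multiple
    of the one at z, and a point is the equation of the divisor times its
    tautological vector. So the two equations differ by that multiple. *)
Lemma lift_local_coeff i j (y z : E2) : chart j z = blowup_lift tphi (chart i y) ->
  coeff j z = coeff i y * coeff j (moving u h i y) /\
  coeff j (moving u h i y) != 0.
Proof.
move=> e; have eL := congr1 (@bl_line R) e.
rewrite bl_line_lift bl_line_chart in eL.
have eM : moving u h i y =
    scaleC2 (coeff j (moving u h i y)) (tautological j z).
  by apply: cline_coeff; rewrite eL; exists 1; rewrite // /scaleC2 !mul1r mkC2K.
have eB : monoidal j z = phi (monoidal i y) := congr1 (@blowdown R) e.
split.
  move: (congr1 (coeff j) eB); rewrite (phi_monoidal tphi) monoidalE.
  by rewrite !coeff_scale coeff_tautological mulr1.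
apply: contra_neq (moving_neq0 tphi i y) => m0.
by rewrite eM m0; apply: C2_eq0; rewrite ?wc_scale ?zc_scale mul0r.
Qed.

(** Pulling the equation of phi back along monoidal i, and using that
    phi o monoidal i = monoidal j o g, both sides acquire an equation of the
    exceptional divisor as a factor. *)
Lemma lift_equation_generic i j x (g : E2 -> E2) :
  local_expr (blowup_lift tphi) i j x g ->
  ext_scale (coeff j (g x)) (wedge (ext_exp (@BB i x))
    (ext_pull ('J g x) (bl_rho j (g x)))) =
  ext_scale (coeff i x * u (monoidal i x)) (bl_rho i x).
Proof.
move=> [[U [oU Ux sg]] e].
have dg : differentiable g x by have [+ _] := sg 1; exact.
have dphi := smooth_differentiable (monoidal i x) (smooth_phi tphi).
have dp := diff_monoidal i x.
have dc : differentiable (phi \o monoidal i) x by exact: differentiable_comp.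
have eB : \forall y \near x, monoidal j (g y) = (phi \o monoidal i) y.
  by apply: filterS e => y /(congr1 (@blowdown R)).
have E1 : ext_pull ('J (monoidal i) x) (pullback phi rho (monoidal i x)) =
    ext_scale (coeff j (g x)) (ext_pull ('J g x) (bl_rho j (g x))).
  rewrite -ext_pull_scale -pullback_monoidal_rho.
  apply: etrans _ (pullback_chain rho dc dg (diff_monoidal j (g x)) eB).
  by apply: esym; apply: pullback_chain dc dp dphi _; near=> y.
apply: etrans (esym (wedge_scaler _ _ _)) _; rewrite -E1.
apply: etrans (esym (wedge_exp_pull _ (B (monoidal i x)) _)) _.
apply: etrans (congr1 (ext_pull _) (auto (monoidal i x))) _.
change (ext_scale (u (monoidal i x)) (pullback (monoidal i) rho x) =
  ext_scale (coeff i x * u (monoidal i x)) (bl_rho i x)).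
by rewrite pullback_monoidal_rho ext_scaleA mulrC.
Unshelve. all: by end_near. Qed.

(** By [lift_local_coeff] both sides of [lift_equation_generic] contain the
    factor coeff i. It cancels off the exceptional divisor, and the resulting
    equation extends by continuity. *)
Lemma lift_equation i j x (g : E2 -> E2) : local_expr (blowup_lift tphi) i j x g ->
  ext_scale (coeff j (moving u h i x)) (wedge (ext_exp (@BB i x))
    (ext_pull ('J g x) (bl_rho j (g x)))) =
  ext_scale (u (monoidal i x)) (bl_rho i x).
Proof.
move=> lg; have [sn e] := lg; have [U [oU Ux sg]] := sn.
apply: extP => k A; rewrite /ext_scale.
have [formB _ _ _] := monoidal_real_closed i.
have cW := ext_cont_wedge (ext_cont_exp (is_form_ext_cont x formB))
  (ext_cont_pull_bl_rho j sn).
apply: (@extend_over_exceptional _ i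
  (fun y => coeff j (moving u h i y) * wedge (ext_exp (@BB i y))
    (ext_pull ('J g y) (bl_rho j (g y))) k A)
  (fun y => u (monoidal i y) * @bl_rho R i y k A)).
- by apply: ccont_mul (cW k A); exact/csmooth_ccont/(csmooth_mult tphi).
- apply: ccont_mul; last exact: ext_cont_bl_rho.
  exact/csmooth_ccont/(csmooth_u_monoidal tphi).
have nU : \forall y \near x, U y by exact: open_nbhs_nbhs.
have ne : \forall y \near x,
    \forall z \near y, chart j (g z) = blowup_lift tphi (chart i z).
  exact: nbhs_interior.
apply: filterS2 nU ne => y Uy ey ci.
have ly : local_expr (blowup_lift tphi) i j y g by split => //; exists U.
have [cj _] := lift_local_coeff (nbhs_singleton ey).
have := congr1 (fun r : ext R => r k A) (lift_equation_generic ly).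
by rewrite cj /ext_scale -!mulrA => /(mulfI ci).
Qed.

Lemma lift_automorphism : diffeomorphism phi ->
  bl_automorphism (blowup_lift tphi) (blowdown_pullback B).
Proof.
move=> dphi; split; first exact: lift_diffeomorphism.
  by split; [exact: monoidal_compatible|exact: monoidal_real_closed].
move=> i j x g lg.
have := lift_equation lg; have [_ e] := lg.
have [_ m0] := lift_local_coeff (nbhs_singleton e).
have u0 := twisted_neq0 tphi (monoidal i x).
move: (coeff j _) (u _) m0 u0 => m t m0 t0.
rewrite -[blowdown_pullback B i x]/(@BB i x).
set W := wedge _ _ => EW.
have WE : W = ext_scale (t / m) (bl_rho i x).
  apply: (ext_scale_inj m0); rewrite EW ext_scaleA; congr ext_scale.
  by rewrite mulrC divfK.
rewrite /bl_canonical /ext_line; apply/seteqP; split.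
  move=> _ [_ [c _ <-] <-]; exists (c * (t / m)) => //.
  by rewrite ext_pull_scale wedge_scaler -/W WE ext_scaleA.
move=> _ [c _ <-]; exists (ext_scale (c / (t / m)) (bl_rho j (g x))).
  by exists (c / (t / m)).
rewrite ext_pull_scale wedge_scaler -/W WE ext_scaleA divfK //.
by rewrite mulf_neq0 // invr_eq0.
Qed.

End Automorphism.

Lemma cexp_neq0 (R : realType) (c : R[i]) : cexp c != 0.
Proof.
rewrite /cexp mulf_neq0 // eq_complex /= negb_and.
  by rewrite gt_eqF ?expR_gt0.
rewrite -negb_and; apply/negP => /andP[/eqP c0 /eqP s0].
have := cos2Dsin2 (complex.Im c); rewrite c0 s0 expr0n addr0 => /eqP.
by rewrite eq_sym oner_eq0.
Qed.

Theorem theorem2p1 (R : realType) (phi : C2 R -> C2 R) (B : dform R) :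
  diffeomorphism phi ->
  phi 0 = 0 ->
  real_closed_2form B ->
  (exists2 lambda : C2 R -> R[i], csmooth lambda &
     forall x : C2 R,
       wedge (ext_exp (B x)) (pullback phi rho x)
       = ext_scale (cexp (lambda x)) (rho x)) ->
  exists phit : blowup R -> blowup R,
    [/\ bl_diffeomorphism phit,
        forall q : blowup R, blowdown (phit q) = phi (blowdown q)
      & bl_automorphism phit (blowdown_pullback B)].
Proof.
move=> dphi phi0 clB [lambda _ auto].
have [psi [_ _ sphi _]] := dphi.
have u0 x : cexp (lambda x) != 0 by exact: cexp_neq0.
have [h [su sh Ew Ez]] := automorphism_normal_form sphi phi0 clB u0 auto.
have tphi : twisted phi (fun x => cexp (lambda x)) h.
  split=> // x; apply: C2_eq; rewrite /twist ?wcK ?zcK; [exact: Ew|exact: Ez].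
exists (blowup_lift tphi); split; [|by []|].
  exact: (lift_diffeomorphism tphi dphi).
exact: (lift_automorphism tphi clB auto dphi).
Qed.
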